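(* Let $(M^n,g)$ be a compact Vaisman manifold of complex dimension $n\geq 2$, and let $c$ be a real constant. Then: (1) If the holomorphic sectional curvature $H$ of the Chern connection is identically equal to $c$, then $g$ is Kähler when $c\neq 0$, and $g$ is Chern flat (that is, the Chern curvature $R$ vanishes identically) when $c=0$. (2) If the holomorphic sectional curvature $H^r$ of the Riemannian (Levi-Civita) connection is identically equal to $c$, then $g$ is Kähler when $c\neq 0$, and $g$ is Riemannian flat (that is, the Riemannian curvature $R^r$ vanishes identically) when $c=0$.
   Context: Let $(M^n,g)$ be a Hermitian manifold of complex dimension $n$; $g=\langle\,,\rangle$ is extended complex multilinearly. It is Vaisman if it is a locally conformally Kähler manifold whose Lee form is parallel under the Riemannian (Levi-Civita) connection. $\nabla$ denotes the Chern connection with curvature $R$, and $\nabla^r$ the Riemannian (Levi-Civita) connection with curvature $R^r$. For a metric connection $D$ with curvature $R^D_{xy}z=D_xD_yz-D_yD_xz-D_{[x,y]}z$, put $R^D(x,y,z,w)=g(R^D_{xy}z,w)$, extended complex multilinearly. Its holomorphic sectional curvature is $H^D(X)=R^D(X,\overline X,X,\overline X)/|X|^4$ for any nonzero complex tangent vector $X$ of type $(1,0)$, where $|X|^2=\langle X,\overline X\rangle$. $H$ and $H^r$ are the cases $D=\nabla$ and $D=\nabla^r$. ''Identically equal to $c$'' means $H^D(X)=c$ for all nonzero $(1,0)$ vectors $X$ at all points. *)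

(* Defs.v *)
From HB Require Import structures.
From mathcomp Require Import all_boot all_order all_algebra.
From mathcomp Require Import complex.
From mathcomp Require Import all_classical all_reals all_analysis.

Set Implicit Arguments.
Unset Strict Implicit.
Unset Printing Implicit Defensive.

Import Order.TTheory GRing.Theory Num.Theory.
Import numFieldNormedType.Exports.

Local Open Scope classical_set_scope.
Local Open Scope ring_scope.

(** Throughout, C^n is the real space of row vectors (x, y), z = x + iy, of
    length n + n, and matrices act on row vectors from the right: the pushforward
    of a tangent vector v under f at x is [v *m jacobian f x], so that
    [jacobian f x a d] is the derivative of the d-th component of f in the a-th
    coordinate direction.  Tensor fields are families of component functions, one
    for each chart, defined on the image of the chart (values outside of it are
    irrelevant) and obeying the transformation law of the tensor. *)

Section Calculus.
Variables (R : realType) (m : nat).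
Implicit Types (f : 'rV[R]_m -> R) (V : set 'rV[R]_m).

Definition partial (a : 'I_m) f : 'rV[R]_m -> R :=
  fun x => 'D_(delta_mx 0 a) f x.

Definition iter_partial (s : seq 'I_m) f : 'rV[R]_m -> R := foldr partial f s.

(** C^infinity on the open set V. *)
Definition smooth_on V f : Prop :=
  forall (s : seq 'I_m) x, V x ->
    {for x, continuous (iter_partial s f)} /\
    forall a, derivable (iter_partial s f) x (delta_mx 0 a).

(** Components of the exterior derivative of the 2-form
    1/2 \sum_(a, b) w_ab dx_a /\ dx_b. *)
Definition ext_deriv2 (w : 'rV[R]_m -> 'M[R]_m) (x : 'rV[R]_m)
    (a b c : 'I_m) : R :=
  partial a (fun y => w y b c) x + partial b (fun y => w y c a) x
  + partial c (fun y => w y a b) x.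

(** Components of the wedge product of a 1-form and a 2-form. *)
Definition wedge12 (t : 'cV[R]_m) (w : 'M[R]_m) (a b c : 'I_m) : R :=
  t a 0 * w b c + t b 0 * w c a + t c 0 * w a b.

End Calculus.

Section ComplexStructure.
Variables (R : realType) (n : nat).

(** (x, y) |-> (- y, x), i.e. multiplication by i. *)
Definition Jmx : 'M[R]_(n + n) := block_mx 0 1%:M (- 1%:M) 0.

(** Complex differentiability: the real differential exists and is C-linear. *)
Definition holomorphic_at (f : 'rV[R]_(n + n) -> 'rV[R]_(n + n))
    (x : 'rV[R]_(n + n)) : Prop :=
  differentiable f x /\ Jmx *m jacobian f x = jacobian f x *m Jmx.

(** Complexified tangent vectors of type (1,0): the i-eigenspace of J. *)
Definition type10 (X : 'rV[R[i]]_(n + n)) : Prop :=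
  X *m map_mx (real_complex R) Jmx = ('i)%C *: X.

(** The 2-form w(u, v) = g(J u, v) attached to the matrix field G of g. *)
Definition fundamental_form (G : 'rV[R]_(n + n) -> 'M[R]_(n + n)) :
    'rV[R]_(n + n) -> 'M[R]_(n + n) :=
  fun x => Jmx *m G x.

Definition kahler_on (V : set 'rV[R]_(n + n))
    (G : 'rV[R]_(n + n) -> 'M[R]_(n + n)) : Prop :=
  forall x, V x -> forall a b c, ext_deriv2 (fundamental_form G) x a b c = 0.

End ComplexStructure.

Arguments Jmx {R n}.

(** [chart_inv i] is an inverse of [chart i] restricted to [dom i]. *)
Record complex_manifold (R : realType) (n : nat) := ComplexManifold {
  carrier :> topologicalType;
  atlas : Type;
  dom : atlas -> set carrier;
  chart : atlas -> carrier -> 'rV[R]_(n + n);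
  chart_inv : atlas -> 'rV[R]_(n + n) -> carrier;
  carrier_hausdorff : hausdorff_space carrier;
  carrier_second_countable : @second_countable carrier;
  dom_cover : forall p, exists i, dom i p;
  dom_open : forall i, open (dom i);
  cod_open : forall i, open (chart i @` dom i);
  chartK : forall i p, dom i p -> chart_inv i (chart i p) = p;
  chart_continuous : forall i p, dom i p -> {for p, continuous (chart i)};
  chart_inv_continuous : forall i p, dom i p ->
    {for chart i p, continuous (chart_inv i)};
  transition_holomorphic : forall i j p, dom i p -> dom j p ->
    holomorphic_at (chart j \o chart_inv i) (chart i p) }.

Section Manifold.
Variables (R : realType) (n : nat) (M : complex_manifold R n).

Definition cod (i : atlas M) : set 'rV[R]_(n + n) := chart i @` dom i.

Definition transition_jacobian (i j : atlas M) :
    'rV[R]_(n + n) -> 'M[R]_(n + n) :=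
  jacobian (chart j \o chart_inv i).

Record hermitian_metric := HermitianMetric {
  gmx : atlas M -> 'rV[R]_(n + n) -> 'M[R]_(n + n);
  gmx_smooth : forall i a b, smooth_on (cod i) (fun x => gmx i x a b);
  gmx_sym : forall i x, cod i x -> (gmx i x)^T = gmx i x;
  gmx_pos : forall i x, cod i x ->
    forall v : 'rV[R]_(n + n), v != 0 -> 0 < (v *m gmx i x *m v^T) 0 0;
  gmx_hermitian : forall i x, cod i x -> Jmx *m gmx i x *m Jmx^T = gmx i x;
  gmx_transition : forall i j p, dom i p -> dom j p ->
    let A := transition_jacobian i j (chart i p) in
    gmx i (chart i p) = A *m gmx j (chart j p) *m A^T }.

Record one_form := OneForm {
  fmx : atlas M -> 'rV[R]_(n + n) -> 'cV[R]_(n + n);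
  fmx_smooth : forall i a, smooth_on (cod i) (fun x => fmx i x a 0);
  fmx_transition : forall i j p, dom i p -> dom j p ->
    fmx i (chart i p) = transition_jacobian i j (chart i p)
                          *m fmx j (chart j p) }.

(** Linear connections on the (real) tangent bundle; [gam i x a b] is the
    coordinate vector of the covariant derivative D_a d_b of the coordinate field
    d_b in the direction d_a. *)
Record connection := Connection {
  gam : atlas M -> 'rV[R]_(n + n) ->
    'I_(n + n) -> 'I_(n + n) -> 'rV[R]_(n + n);
  gam_smooth : forall i a b d, smooth_on (cod i) (fun x => gam i x a b 0 d);
  gam_transition : forall i j p, dom i p -> dom j p ->
    let A := transition_jacobian i j (chart i p) in
    forall a b,
      gam i (chart i p) a b *m A =
        \row_d partial a (fun x => transition_jacobian i j x b d) (chart i p)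
        + \sum_e \sum_f (A a e * A b f) *: gam j (chart j p) e f }.

Implicit Types (g : hermitian_metric) (D : connection) (t : one_form).

(** D g = 0 *)
Definition metric_connection g D : Prop :=
  forall i x, cod i x -> forall a b c,
    partial a (fun y => gmx g i y b c) x =
      (gam D i x a b *m gmx g i x) 0 c + (gam D i x a c *m gmx g i x) 0 b.

(** D J = 0: as J has constant coefficients in a chart, this says
    D_a (J d_b) = J (D_a d_b). *)
Definition complex_connection D : Prop :=
  forall i x, cod i x -> forall a b,
    \sum_c (Jmx b c) *: gam D i x a c = gam D i x a b *m Jmx.

Definition torsion D (i : atlas M) (x : 'rV[R]_(n + n)) (a b : 'I_(n + n)) :
    'rV[R]_(n + n) :=
  gam D i x a b - gam D i x b a.

Definition torsionC D (i : atlas M) (x : 'rV[R]_(n + n))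
    (X Y : 'rV[R[i]]_(n + n)) : 'rV[R[i]]_(n + n) :=
  \sum_a \sum_b (X 0 a * Y 0 b) *: map_mx (real_complex R) (torsion D i x a b).

Definition levi_civita g D : Prop :=
  metric_connection g D /\ forall i x, cod i x -> forall a b, torsion D i x a b = 0.

(** The Chern connection is the unique connection with D g = 0, D J = 0 and
    torsion without (1,1)-part. *)
Definition chern_connection g D : Prop :=
  [/\ metric_connection g D, complex_connection D &
      forall i x, cod i x -> forall X Y : 'rV[R[i]]_(n + n),
        type10 X -> type10 Y -> torsionC D i x X (map_mx Num.conj Y) = 0].

(** Coordinate vector of R_ab d_c = D_a D_b d_c - D_b D_a d_c. *)
Definition curvature D (i : atlas M) (x : 'rV[R]_(n + n))
    (a b c : 'I_(n + n)) : 'rV[R]_(n + n) :=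
  \row_e (partial a (fun y => gam D i y b c 0 e) x
          - partial b (fun y => gam D i y a c 0 e) x)
  + \sum_d (gam D i x b c 0 d *: gam D i x a d
            - gam D i x a c 0 d *: gam D i x b d).

Definition flat D : Prop :=
  forall i x, cod i x -> forall a b c, curvature D i x a b c = 0.

(** Complex multilinear extensions of g(u, v) and of
    R(x, y, z, w) = g(R_xy z, w). *)
Definition gC g (i : atlas M) (x : 'rV[R]_(n + n))
    (X Y : 'rV[R[i]]_(n + n)) : R[i] :=
  \sum_a \sum_b X 0 a * Y 0 b * (gmx g i x a b)%:C%C.

Definition RmC g D (i : atlas M) (x : 'rV[R]_(n + n))
    (X Y Z W : 'rV[R[i]]_(n + n)) : R[i] :=
  \sum_a \sum_b \sum_c \sum_e
    X 0 a * Y 0 b * Z 0 c * W 0 e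
    * ((curvature D i x a b c *m gmx g i x) 0 e)%:C%C.

Definition hol_sec_curv g D (i : atlas M) (x : 'rV[R]_(n + n))
    (X : 'rV[R[i]]_(n + n)) : R[i] :=
  let Xbar := map_mx Num.conj X in
  RmC g D i x X Xbar X Xbar / gC g i x X Xbar ^+ 2.

Definition hol_sec_curv_const g D (c : R) : Prop :=
  forall i x, cod i x -> forall X : 'rV[R[i]]_(n + n),
    type10 X -> X != 0 -> hol_sec_curv g D i x X = c%:C%C.

Definition kahler g : Prop := forall i, kahler_on (cod i) (gmx g i).

(** Every point has a neighbourhood on which some conformal multiple exp(f) g is
    Kaehler. *)
Definition locally_conformally_kahler g : Prop :=
  forall i x, cod i x ->
    exists (W : set 'rV[R]_(n + n)) (f : 'rV[R]_(n + n) -> R),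
      [/\ open W, W x, W `<=` cod i, smooth_on W f &
          kahler_on W (fun y => expR (f y) *: gmx g i y)].

(** The Lee form is the 1-form t with d w = t /\ w (unique when 2 <= n); other
    normalizations differ by a nonzero constant factor. *)
Definition lee_form g t : Prop :=
  forall i x, cod i x -> forall a b c,
    ext_deriv2 (fundamental_form (gmx g i)) x a b c =
    wedge12 (fmx t i x) (fundamental_form (gmx g i) x) a b c.

Definition parallel_form D t : Prop :=
  forall i x, cod i x -> forall a b,
    partial a (fun y => fmx t i y b 0) x = (gam D i x a b *m fmx t i x) 0 0.

(** Dr is meant to be the Levi-Civita connection of g.  A Kaehler metric is
    Vaisman, with zero Lee form. *)
Definition vaisman g Dr : Prop :=
  locally_conformally_kahler g /\
  exists t, lee_form g t /\ parallel_form Dr t.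

End Manifold.

(* Main.v *)
Require Import Defs.
From mathcomp Require Import all_boot all_order all_algebra.
From mathcomp Require Import ring lra complex.
From mathcomp Require Import all_classical all_reals all_analysis.

(** The proof is local and pointwise, and gives more than is claimed: under
    either curvature hypothesis the Lee form t vanishes, whatever c is, so that
    g is Kaehler.  It compares three connections: the Levi-Civita connection
    Dr, the Chern connection D, and the Weyl connection W, which locally is the
    Levi-Civita connection of the Kaehler metrics conformal to g.  Write t also
    for the Lee vector, |t|^2 for its square norm, and J for the complex
    structure.

    - Uniqueness of the Chern connection gives D - Dr in terms of t
      ([chern_minus_levi_civita]).  With
      W = D - 1/2 (t(u) - t(Ju) J) it says that W - Dr is the tensor
      E(u)z = - 1/2 (t(u) z + t(z) u - g(u, z) t)
      ([weyl_shift_low], [along_weyl_shift]).  W is used only through this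
      formula: neither a conformal Kaehler metric nor an inverse of the metric
      matrix has to be differentiated.
    - As t is Dr-parallel, the covariant derivative of E contributes nothing
      to the curvature of W, and R^W = R^Dr + [E, E], an explicit
      Kulkarni-Nomizu product ([curv_mx_conformal], [weyl_diff_comm]).  On the
      other hand W - D takes values in the span of the identity and J, which
      commute with D, so R^W - R^D = 1/2 d(t o J) J ([curv_mx_shift]).
    - Hence S = R^W has the symmetries of R^Dr, it is J-invariant like R^D,
      and it vanishes on t, because R^Dr does (t is parallel) and [E, E] does.
      Constant holomorphic sectional curvature c of D or of Dr becomes
      S(u, Ju, Ju, u) = c |u|^4
         + k |u|^2 (t(u)^2 + t(Ju)^2 - |t|^2 |u|^2)
      with k = 1/2 for D and k = 1/4 for Dr ([chern_hol_sec_curv],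
      [riemann_hol_sec_curv]).
    - The left side vanishes at u = t, the k-term too, so c |t|^4 = 0.  If t
      were not 0, then c = 0; as n >= 2 there is y <> 0 orthogonal to t and Jt.
      The left side takes the same value at y and at t + y, while the right
      sides differ by k |t|^4 |y|^2: a contradiction ([lee_vector_eq0]).
    - With t = 0 the three connections agree, and if moreover c = 0 the
      J-invariant curvature tensor S has zero holomorphic sectional curvature,
      so it is 0 by polarization ([holomorphic_sectional_curvature_eq0]).

    Symmetry of second derivatives ([derive_comm]) enters twice: through
    [curv_mx_metric], the skew-symmetry of the curvature of a metric
    connection, and through [curv_mx_parallel]. *)

Set Implicit Arguments.
Unset Strict Implicit.
Unset Printing Implicit Defensive.

Import Order.TTheory GRing.Theory Num.Theory.
Import numFieldNormedType.Exports.

Local Open Scope classical_set_scope.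
Local Open Scope ring_scope.

(** * Algebraic curvature tensors *)

Section CurvatureTensors.
Variables (R : realFieldType) (V : zmodType) (S : V -> V -> V -> V -> R).
Hypothesis S_addl : forall x x' y z w, S (x + x') y z w = S x y z w + S x' y z w.
Hypothesis S_skew12 : forall x y z w, S y x z w = - S x y z w.
Hypothesis S_skew34 : forall x y z w, S x y w z = - S x y z w.
Hypothesis S_bianchi : forall x y z w, S x y z w + S y z x w + S z x y w = 0.

(** A signed sum of the Bianchi identities at the four cyclic rotations of
    (x, y, z, w). *)
Lemma curvature_pair_sym x y z w : S x y z w = S z w x y.
Proof.
have := (S_bianchi x y z w, S_bianchi y z w x, S_bianchi z w x y,
  S_bianchi w x y z).
have := (S_skew34 x y z w, S_skew34 z w x y, S_skew34 y z x w,
  S_skew34 x z y w, S_skew34 y w z x, S_skew34 w x y z).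
have := (S_skew12 x w y z, S_skew12 x w z y, S_skew12 y w z x,
  S_skew12 y w x z, S_skew12 x z y w, S_skew12 x z w y).
have := (S_skew34 w x z y, S_skew34 z x y w, S_skew34 w y z x).
move=> [[? ?] ?] [[[[[? ?] ?] ?] ?] ?] [[[[[? ?] ?] ?] ?] ?] [[[? ?] ?] ?].
lra.
Qed.

Lemma curvature_addl2 x y y' z w : S x (y + y') z w = S x y z w + S x y' z w.
Proof. rewrite S_skew12 S_addl (S_skew12 x y) (S_skew12 x y'); lra. Qed.

Lemma curvature_addl3 x y z z' w : S x y (z + z') w = S x y z w + S x y z' w.
Proof. by rewrite !(curvature_pair_sym x y) S_addl. Qed.

Lemma curvature_addl4 x y z w w' : S x y z (w + w') = S x y z w + S x y z w'.
Proof. by rewrite !(curvature_pair_sym x y) curvature_addl2. Qed.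

Let S_add := (S_addl, curvature_addl2, curvature_addl3, curvature_addl4).

(** Polarizing twice makes S cyclic in its last three arguments, and the
    Bianchi identity then says 3 S = 0. *)
Lemma sectional_curvature_eq0 : (forall x y, S x y x y = 0) ->
  forall x y z w, S x y z w = 0.
Proof.
move=> S0.
have S1 x y z : S x y z y = 0.
  have := S0 (x + z) y; rewrite !S_add !S0 (curvature_pair_sym z y x y); lra.
have S2 x y z w : S x y z w = S x w y z.
  have := S1 x (y + w) z; rewrite !S_add !S1 (S_skew34 x w y z); lra.
move=> x y z w; have := S_bianchi x y z w.
by have := (S2 x y z w, S2 x w y z, S_skew12 x z y w, S_skew34 y z x w,
  curvature_pair_sym y z w x, S_skew12 x w y z, S_skew34 x z w y)
 => -[[[[[[? ?] ?] ?] ?] ?] ?]; lra.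
Qed.

Variable J : V -> V.
Hypothesis JK : forall x, J (J x) = - x.
Hypothesis S_J : forall x y z w, S x y (J z) (J w) = S x y z w.

Let S_J12 x y z w : S (J x) (J y) z w = S x y z w.
Proof. by rewrite curvature_pair_sym S_J -curvature_pair_sym. Qed.

Let S_opp1 x y z w : S (- x) y z w = - S x y z w.
Proof.
have S0 : S 0 y z w = 0 by have := S_addl 0 0 y z w; rewrite addr0; lra.
by have := S_addl x (- x) y z w; rewrite subrr S0; lra.
Qed.

(** The polarized hypothesis and the Bianchi identity give
    3 S(x, Jy, x, Jy) + S(x, y, x, y) = 0; with Jy in place of y the two terms
    exchange their roles, so the sectional curvatures vanish. *)
Lemma holomorphic_sectional_curvature_eq0 : (forall x, S x (J x) x (J x) = 0) ->
  (forall x y, J (x + y) = J x + J y) ->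
  forall x y z w, S x y z w = 0.
Proof.
move=> S0 J_add.
have JN x : J (- x) = - J x.
  by rewrite -(JK x) JK.
have S_J21 x y z w : S x (J y) z w = S y (J x) z w.
  by rewrite -(S_J12 x) JK S_skew12 S_opp1; lra.
(* add the quartic forms at x + y and x - y: the part of bidegree (2, 2) *)
have S22 x y : S x (J x) y (J y) + 2 * S x (J y) x (J y) = 0.
  have Sp := S0 (x + y); have Sm := S0 (x - y).
  have SJ' u v a b : S u v a (J b) = S u v b (J a).
    by rewrite !(curvature_pair_sym u v) S_J21.
  have opp2 u v a b : S u (- v) a b = - S u v a b.
    by rewrite S_skew12 S_opp1 S_skew12; lra.
  have opp3 u v a b : S u v (- a) b = - S u v a b.
    by rewrite !(curvature_pair_sym u v) S_opp1.
  have opp4 u v a b : S u v a (- b) = - S u v a b.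
    by rewrite !(curvature_pair_sym u v) opp2.
  rewrite !J_add !S_add !S0 in Sp.
  rewrite !J_add !JN !S_add !S_opp1 !opp2 !opp3 !opp4 !S0 in Sm.
  move: Sp Sm.
  rewrite !(S_J21 y x) !(SJ' _ _ y x) (curvature_pair_sym y (J y) x (J x)).
  lra.
have S3 x y : 3 * S x (J y) x (J y) + S x y x y = 0.
  have := S_bianchi x (J x) y (J y); have := S22 x y.
  rewrite (S_skew12 x y) S_J (S_skew34 x y y x) -(S_J12 (J x) y) JK S_opp1.
  by rewrite (S_skew34 x y x y); lra.
apply: sectional_curvature_eq0 => x y.
have := S3 x y; have := S3 x (J y); rewrite JK.
rewrite (S_skew12 (- y)) S_opp1 (S_skew34 _ _ (- y)).
by rewrite (curvature_pair_sym _ _ (- y)) S_opp1 (S_skew12 x y) (S_skew34 x y); lra.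
Qed.

End CurvatureTensors.

(** * Hermitian spaces with a Lee vector *)

Section HermitianVectorSpace.
Variables (R : realFieldType) (V : lmodType R).
Variables (g : V -> V -> R) (J : {linear V -> V}).
Hypothesis g_linear : forall k u v w, g (k *: u + v) w = k * g u w + g v w.
Hypothesis g_sym : forall u v, g u v = g v u.
Hypothesis g_pos : forall u, u != 0 -> 0 < g u u.
Hypothesis JK : forall u, J (J u) = - u.
Hypothesis g_J : forall u v, g (J u) (J v) = g u v.

Lemma form0l v : g 0 v = 0.
Proof. by have := g_linear (-1) 0 0 v; rewrite scaler0 addr0; lra. Qed.

Lemma formDl u v w : g (u + v) w = g u w + g v w.
Proof. by rewrite -[u]scale1r g_linear scale1r mul1r. Qed.

Lemma formZl k u w : g (k *: u) w = k * g u w.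
Proof. by rewrite -[k *: u]addr0 g_linear form0l addr0. Qed.

Lemma formNl u w : g (- u) w = - g u w.
Proof. by rewrite -scaleN1r formZl mulN1r. Qed.

Lemma formDr u v w : g w (u + v) = g w u + g w v.
Proof. by rewrite !(g_sym w) formDl. Qed.

Lemma formZr k u w : g w (k *: u) = k * g w u.
Proof. by rewrite !(g_sym w) formZl. Qed.

Lemma formNr u w : g w (- u) = - g w u.
Proof. by rewrite !(g_sym w) formNl. Qed.

Let gE := (formDl, formDr, formZl, formZr, formNl, formNr).

Lemma formJl u v : g (J u) v = - g u (J v).
Proof. by rewrite -(g_J u) JK formNr opprK. Qed.

Lemma formJ_skew u v : g (J v) u = - g (J u) v.
Proof. by rewrite formJl g_sym. Qed.

Lemma formJ_diag u : g (J u) u = 0.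
Proof. by have := formJ_skew u u; lra. Qed.

Lemma form_eq0 u : g u u = 0 -> u = 0.
Proof. by move=> u0; apply/eqP/negPn/negP => /g_pos; rewrite u0 ltxx. Qed.

Lemma form_inj u v : (forall w, g u w = g v w) -> u = v.
Proof.
by move=> uv; apply/subr0_eq/form_eq0; rewrite formDl formNl uv subrr.
Qed.

(** Gr and GD stand for two connections applied to constant vector fields: Gr is
    torsion free, and GD is complex, with torsion T free of (1,1)-part.  In
    [T_lee], the left side is the exterior derivative of the fundamental form
    computed with GD, and the right side is its product with the Lee form. *)
Section ChernMinusLeviCivita.
Variables (Gr GD : V -> V -> V) (t : V).
Hypothesis Gr_sym : forall u v, Gr u v = Gr v u.
Hypothesis GD_opp : forall u v, GD (- u) v = - GD u v.
Hypothesis GD_J : forall u v, GD u (J v) = J (GD u v).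
Let T u v := GD u v - GD v u.
Hypothesis T11 : forall u v, T (J u) v = T u (J v).

(** Integrability: J has constant components, so GD commutes with J in its second
    argument.  The defect C of J-linearity in the first argument is skew-symmetric
    because T has no (1,1)-part; it is J-linear in one argument and conjugate
    linear in the other, so it vanishes. *)
Lemma torsion_J u v : T (J u) v = J (T u v).
Proof.
pose C x y := GD (J x) y - J (GD x y).
have C_skew x y : C y x = - C x y.
  apply: form_inj => w; have := congr1 (g ^~ w) (T11 x y).
  by rewrite /T /C !GD_J !gE; lra.
have CJr x y : C x (J y) = J (C x y) by rewrite /C !GD_J linearB.
have CJl x y : C (J x) y = - J (C x y).
  by rewrite /C JK GD_opp linearB JK opprD !opprK addrC.
have C0 x y : C x y = 0.
  have CJl' : J (C x y) = - J (C x y).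
    by rewrite -CJl (C_skew y (J x)) CJr (C_skew x y) linearN opprK.
  apply: form_eq0; rewrite -g_J; have := congr1 (g ^~ (J (C x y))) CJl'.
  by rewrite /= formNl; lra.
have GD_Jl x y : GD (J x) y = J (GD x y) by apply: subr0_eq; apply: C0.
by rewrite /T GD_Jl GD_J -linearB.
Qed.

Hypothesis T_lee : forall u v w,
  g (J (T u v)) w + g (J (T v w)) u + g (J (T w u)) v =
  g u t * g (J v) w + g v t * g (J w) u + g w t * g (J u) v.

(** Put tau(u, v, w) = g(J T(u, v), w).  As T(Ju, v) = T(u, Jv) = J T(u, v), the
    arguments of [T_lee] may be changed from (u, v, Jw) to (Ju, Jv, Jw): this
    reverses the sign of tau(u, v, Jw) = g(T(u, v), w) and of no other torsion
    term.  Subtract. *)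
Lemma torsion_lee u v w : 2 * g (T u v) w =
  g u t * g v w - g v t * g u w - g (J u) t * g (J v) w + g (J v) t * g (J u) w.
Proof.
have TJr x y : T x (J y) = J (T x y) by rewrite -T11 torsion_J.
have h1 := T_lee u v (J w); have h2 := T_lee (J u) (J v) (J w).
rewrite !(torsion_J, TJr, JK, linearN, g_J, formNl, formNr) in h1 h2.
by rewrite (g_sym w (J u)) (g_sym w u) in h1 h2; lra.
Qed.

Hypothesis B_skew : forall u v w,
  g (GD u v - Gr u v) w + g v (GD u w - Gr u w) = 0.

(** The Koszul formula: a g-skew tensor u, v |-> B u v is determined by its
    antisymmetrization, here the torsion of GD. *)
Lemma chern_minus_levi_civita u v w : 2 * g (GD u v - Gr u v) w =
  - (g v t * g u w - g u v * g w t) - g (J u) t * g (J v) w.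
Proof.
have TB x y : T x y = (GD x y - Gr x y) - (GD y x - Gr y x).
  by rewrite (Gr_sym y x) opprB addrA subrK.
have := (torsion_lee u v w, torsion_lee v w u, torsion_lee w u v).
have := (formJ_skew u v, formJ_skew u w, formJ_skew v w, g_sym v u, g_sym w u, g_sym w v).
have := (B_skew u v w, B_skew v w u, B_skew w u v).
rewrite !TB !(formDl, formNl, formDr, formNr).
move=> [[b1 b2] b3] [[[[[j1 j2] j3] s1] s2] s3] [[t1 t2] t3].
rewrite j1 j2 j3 s1 s2 s3 in t1 t2 t3 *.
rewrite !(g_sym v) in b1 b2 b3 t1 t2 t3 *.
rewrite !(g_sym w) in b1 b2 b3 t1 t2 t3 *.
rewrite !(g_sym u) in b1 b2 b3 t1 t2 t3 *.
lra.
Qed.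
End ChernMinusLeviCivita.

Section WeylCurvature.
Variable t : V.

(** Weyl connection minus Levi-Civita connection. *)
Definition weyl_diff u z : V :=
  - (1 / 2) *: (g u t *: z + g z t *: u - g u z *: t).

(** The Kulkarni-Nomizu product [weyl_corr] of this form with g is the curvature
    of the Weyl connection minus that of the Levi-Civita connection. *)
Definition schouten u v : R := g u t * g v t / 4 - g t t * g u v / 8.

Definition weyl_corr u v z w : R :=
  g u w * schouten v z + schouten u w * g v z
  - g u z * schouten v w - schouten u z * g v w.

(** The exterior derivative of the 1-form t o J when t is parallel. *)
Definition lee_twist u v : R :=
  g u t * g (J v) t - g v t * g (J u) t - g t t * g u (J v).

Lemma weyl_diff_sym u v : weyl_diff u v = weyl_diff v u.
Proof. by rewrite /weyl_diff (addrC (g u t *: v)) (g_sym u v). Qed.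

Lemma weyl_diff_lee u v :
  g (weyl_diff u v) t = - g u t * g v t + g t t * g u v / 2.
Proof. by rewrite /weyl_diff !gE; lra. Qed.

(** The commutator of the endomorphisms E(u) and E(v), lowered by g. *)
Lemma weyl_diff_comm u v z w :
  g (weyl_diff u (weyl_diff v z)) w - g (weyl_diff v (weyl_diff u z)) w
  = weyl_corr u v z w.
Proof.
rewrite /weyl_corr /schouten /weyl_diff !gE.
rewrite (g_sym v u) (g_sym t w); lra.
Qed.

Variable S : V -> V -> V -> V -> R.
Hypothesis S_addl : forall x x' y z w, S (x + x') y z w = S x y z w + S x' y z w.
Hypothesis S_skew12 : forall x y z w, S y x z w = - S x y z w.
Hypothesis S_skew34 : forall x y z w, S x y w z = - S x y z w.
Hypothesis S_bianchi : forall x y z w, S x y z w + S y z x w + S z x y w = 0.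
Hypothesis S_J : forall x y z w, S x y (J z) (J w) = S x y z w.
Hypothesis S_lee : forall x y z, S x y z t = 0.
Variables (c k : R) (y : V).
Hypothesis k_neq0 : k != 0.
Hypotheses (y_neq0 : y != 0) (y_t : g y t = 0) (y_Jt : g y (J t) = 0).
Hypothesis S_hol : forall u, S u (J u) (J u) u =
  c * g u u ^+ 2 + k * g u u * (g u t ^+ 2 + g (J u) t ^+ 2 - g t t * g u u).

(** S vanishes as soon as one argument is t or Jt.  So the quartic form
    S(u, Ju, Ju, u) is 0 at t, and is the same at y as at t + y. *)
Lemma lee_vector_eq0 : t = 0.
Proof.
have S_sym := curvature_pair_sym S_skew12 S_skew34 S_bianchi.
have S_add := (S_addl, curvature_addl2 S_addl S_skew12,
  curvature_addl3 S_addl S_skew12 S_skew34 S_bianchi,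
  curvature_addl4 S_addl S_skew12 S_skew34 S_bianchi).
have t3 u v w : S u v t w = 0 by rewrite S_skew34 S_lee oppr0.
have Jt4 u v w : S u v w (J t) = 0.
  by rewrite -[w]opprK -JK S_J S_lee.
have Jt3 u v w : S u v (J t) w = 0 by rewrite S_skew34 Jt4 oppr0.
have t1 u v w : S t u v w = 0 by rewrite S_sym t3.
have Jt2 u v w : S u (J t) v w = 0 by rewrite S_sym Jt4.
have ht := S_hol t; have hy := S_hol y; have hty := S_hol (t + y).
move: ht hy hty; rewrite linearD !S_add !(t1, t3, S_lee, Jt2, Jt3, Jt4) => ht hy.
rewrite !add0r hy !gE formJ_diag formJl y_Jt (g_sym t y) y_t => hty.
apply: contraTeq isT => t_neq0.
have := (g_pos t_neq0, g_pos y_neq0) => -[tt0 yy0].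
rewrite formJ_diag in ht.
have c0 : c = 0.
  have : c * g t t ^+ 2 = 0 by lra.
  by move/eqP; rewrite mulf_eq0 expf_eq0 /= (gt_eqF tt0) orbF => /eqP.
have : k * g t t ^+ 2 * g y y = 0 by move: hty; rewrite c0; lra.
by move/eqP; rewrite !mulf_eq0 (gt_eqF tt0) (gt_eqF yy0) (negPf k_neq0).
Qed.
End WeylCurvature.

(** Rr and RD stand for the Levi-Civita and the Chern curvature, S for that of the
    Weyl connection. *)
Section ConstantHolomorphicCurvature.
Variables (t : V) (Rr RD : V -> V -> V -> V -> R).
Hypothesis Rr_addl :
  forall x x' y z w, Rr (x + x') y z w = Rr x y z w + Rr x' y z w.
Hypothesis Rr_skew12 : forall x y z w, Rr y x z w = - Rr x y z w.
Hypothesis Rr_skew34 : forall x y z w, Rr x y w z = - Rr x y z w.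
Hypothesis Rr_bianchi :
  forall x y z w, Rr x y z w + Rr y z x w + Rr z x y w = 0.
Hypothesis Rr_lee : forall x y z, Rr x y z t = 0.
Hypothesis RD_Rr : forall x y z w,
  RD x y z w = Rr x y z w + weyl_corr t x y z w - lee_twist t x y * g (J z) w / 2.
Hypothesis RD_J : forall x y z w, RD x y (J z) (J w) = RD x y z w.

Let S x y z w := Rr x y z w + weyl_corr t x y z w.

Let S_addl x x' y z w : S (x + x') y z w = S x y z w + S x' y z w.
Proof. by rewrite /S Rr_addl /weyl_corr /schouten !gE; lra. Qed.

Let S_skew12 x y z w : S y x z w = - S x y z w.
Proof. by rewrite /S Rr_skew12 /weyl_corr; lra. Qed.

Let S_skew34 x y z w : S x y w z = - S x y z w.
Proof. by rewrite /S Rr_skew34 /weyl_corr; lra. Qed.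

Let schouten_sym x y : schouten t x y = schouten t y x.
Proof. by rewrite /schouten (g_sym x y); lra. Qed.

Let S_bianchi x y z w : S x y z w + S y z x w + S z x y w = 0.
Proof.
have := Rr_bianchi x y z w; rewrite /S /weyl_corr (schouten_sym z x).
by rewrite (schouten_sym z y) (schouten_sym y x) (g_sym z x) (g_sym z y)
  (g_sym y x); lra.
Qed.

Let S_J x y z w : S x y (J z) (J w) = S x y z w.
Proof.
have := RD_J x y z w; rewrite !RD_Rr (g_J (J z)) /S; lra.
Qed.

Let S_lee x y z : S x y z t = 0.
Proof.
rewrite /S Rr_lee /weyl_corr /schouten (g_sym x z) (g_sym y z); lra.
Qed.

Lemma chern_hol_sec_curv u : S u (J u) (J u) u = RD u (J u) (J u) u +
  1 / 2 * g u u * (g u t ^+ 2 + g (J u) t ^+ 2 - g t t * g u u).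
Proof. by rewrite RD_Rr /lee_twist JK !gE /S; lra. Qed.

Lemma riemann_hol_sec_curv u : S u (J u) (J u) u = Rr u (J u) (J u) u +
  1 / 4 * g u u * (g u t ^+ 2 + g (J u) t ^+ 2 - g t t * g u u).
Proof. by rewrite /S /weyl_corr /schouten g_J formJ_diag (g_sym u (J u)) formJ_diag; lra. Qed.

Variables (c : R) (y : V).
Hypotheses (y_neq0 : y != 0) (y_t : g y t = 0) (y_Jt : g y (J t) = 0).

Lemma const_hol_sec_curv_lee_vector :
  (forall u, RD u (J u) (J u) u = c * g u u ^+ 2) \/
  (forall u, Rr u (J u) (J u) u = c * g u u ^+ 2) -> t = 0.
Proof.
move=> H.
have [k k0 Hk] : exists2 k : R, k != 0 & forall u, S u (J u) (J u) u =
  c * g u u ^+ 2 + k * g u u * (g u t ^+ 2 + g (J u) t ^+ 2 - g t t * g u u).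
  case: H => H; [exists (1 / 2) | exists (1 / 4)]; try by apply: lt0r_neq0; lra.
    by move=> u; rewrite chern_hol_sec_curv H.
  by move=> u; rewrite riemann_hol_sec_curv H.
exact: (lee_vector_eq0 S_addl S_skew12 S_skew34 S_bianchi S_J S_lee k0
  y_neq0 y_t y_Jt Hk).
Qed.

Lemma const_hol_sec_curv_flat : c = 0 ->
  (forall u, RD u (J u) (J u) u = c * g u u ^+ 2) \/
  (forall u, Rr u (J u) (J u) u = c * g u u ^+ 2) ->
  forall x y z w, RD x y z w = 0 /\ Rr x y z w = 0.
Proof.
move=> c0 H; have t0 := const_hol_sec_curv_lee_vector H.
have gt0 x : g x t = 0 by rewrite t0 g_sym form0l.
have RDE u v z w : RD u v z w = Rr u v z w.
  by rewrite RD_Rr /lee_twist /weyl_corr /schouten !gt0; lra.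
have Rr0 u v z w : Rr u v z w = 0.
  apply: (holomorphic_sectional_curvature_eq0 Rr_addl Rr_skew12 Rr_skew34
    Rr_bianchi JK) => [x1 x2 x3 x4|x|x1 x2].
  - by rewrite -!RDE RD_J.
  - by rewrite Rr_skew34; case: H => /(_ x); rewrite ?RDE c0 mul0r => ->; rewrite oppr0.
  - exact: linearD.
by move=> u v z w; rewrite RDE Rr0.
Qed.
End ConstantHolomorphicCurvature.

End HermitianVectorSpace.

(** * Symmetry of second derivatives *)

Section Schwarz.
Variables (R : realType) (V : normedModType R).
Implicit Types (f : V -> R) (x v w : V).

Lemma is_derive_line f x v (s : R) : derivable f (x + s *: v) v ->
  is_derive s 1 (fun r : R => f (x + r *: v)) ('D_v f (x + s *: v)).
Proof.
have E : (fun h : R => h^-1 *: (f (x + (h *: 1 + s) *: v) - f (x + s *: v))) =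
    (fun h : R => h^-1 *: (f (h *: v + (x + s *: v)) - f (x + s *: v))).
  by apply/funext => h; rewrite scalerDl addrCA /GRing.scale /= mulr1.
move=> df; apply: DeriveDef; first by rewrite /derivable /= E.
by rewrite /derive /= E.
Qed.

Lemma mean_value_line f x v (h : R) : 0 < h ->
  (forall s : R, 0 <= s <= h -> derivable f (x + s *: v) v) ->
  exists2 s : R, 0 <= s <= h & f (x + h *: v) - f x = h * 'D_v f (x + s *: v).
Proof.
move=> h0 df.
have [s||s] := @MVT R (fun r : R => f (x + r *: v))
  (fun s => 'D_v f (x + s *: v)) 0 h h0.
- rewrite in_itv /= => /andP[s0 sh].
  by apply/is_derive_line/df; rewrite !ltW.
- apply: derivable_within_continuous => s; rewrite in_itv /= => sh.
  by have [] := is_derive_line (df s sh).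
rewrite in_itv /= scale0r addr0 subr0 mulrC => /andP[s0 sh] E.
by exists s => //; rewrite !ltW.
Qed.

Lemma is_derive_translate f x v w : derivable f (x + w) v ->
  is_derive x v (fun y => f (y + w)) ('D_v f (x + w)).
Proof.
have E : (fun h : R => h^-1 *: (f (h *: v + x + w) - f (x + w))) =
    (fun h : R => h^-1 *: (f (h *: v + (x + w)) - f (x + w))).
  by apply/funext => h; rewrite addrA.
move=> df; apply: DeriveDef; first by rewrite /derivable /= E.
by rewrite /derive /= E.
Qed.

(** The second difference is the first difference along v of f(. + h w) - f; apply
    the mean value theorem along v, then along w. *)
Lemma second_difference f x v w (h : R) : 0 < h ->
  (forall s r : R, 0 <= s <= h -> 0 <= r <= h ->
     derivable f (x + s *: v + r *: w) v /\
     derivable ('D_v f) (x + s *: v + r *: w) w) ->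
  exists s r : R, [/\ 0 <= s <= h, 0 <= r <= h &
    f (x + h *: v + h *: w) - f (x + h *: v) - (f (x + h *: w) - f x)
    = h * (h * 'D_w ('D_v f) (x + s *: v + r *: w))].
Proof.
move=> h0 df; have h0h : 0 <= h <= h by rewrite lexx ltW.
have h00 : (0 : R) <= 0 <= h by rewrite lexx ltW.
pose phi y := f (y + h *: w) - f y.
have dphi (s : R) : 0 <= s <= h -> is_derive (x + s *: v) v phi
    ('D_v f (x + s *: v + h *: w) - 'D_v f (x + s *: v)).
  move=> sh; apply: is_deriveB.
    by apply: is_derive_translate; have [] := df _ _ sh h0h.
  by apply: derivableP; have [] := df _ _ sh h00; rewrite scale0r addr0.
have [|s sh] := @mean_value_line phi x v h h0.
  by move=> s /dphi[].
have [_ ->] := dphi s sh.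
have [|r rh ->] := @mean_value_line ('D_v f) (x + s *: v) w h h0.
  by move=> r rh; have [] := df s r sh rh.
by move=> E; exists s, r.
Qed.

Lemma near_ball3 (P Q S : V -> Prop) x :
  (\forall y \near x, P y) -> (\forall y \near x, Q y) ->
  (\forall y \near x, S y) ->
  exists2 d : R, 0 < d & forall y, ball x d y -> [/\ P y, Q y & S y].
Proof.
move=> nP nQ nS.
have /nbhs_ballP[d /= d0 bd] : \forall y \near x, [/\ P y, Q y & S y].
  by near=> y; split; near: y.
by exists d.
Unshelve. all: by end_near. Qed.

Lemma dist_le_of_common_value (a b p q e : R) :
  `|a - p| < e / 2 -> `|b - q| < e / 2 -> p = q -> `|a - b| <= e.
Proof. by move=> ap bq pq; move: ap bq; rewrite pq !ltr_norml ler_norml; lra. Qed.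

(** Schwarz's theorem: the second difference is symmetric in v and w, so both
    mixed derivatives take a common value, up to position, near x. *)
Lemma derive_comm f x v w :
  (\forall y \near x, [/\ derivable f y v, derivable f y w,
    derivable ('D_v f) y w & derivable ('D_w f) y v]) ->
  {for x, continuous ('D_w ('D_v f))} -> {for x, continuous ('D_v ('D_w f))} ->
  'D_w ('D_v f) x = 'D_v ('D_w f) x.
Proof.
move=> df cvw cwv; apply/eqP; rewrite -subr_eq0 -normr_le0.
apply/ler_addgt0Pl => e e0; rewrite addr0.
have e20 : 0 < e / 2 by rewrite divr_gt0.
move/cvgrPdist_lt : cvw => /(_ _ e20) cvw.
move/cvgrPdist_lt : cwv => /(_ _ e20) cwv.
have {df cvw cwv} [d d0 bd] := near_ball3 df cvw cwv.
pose N := `|v| + `|w| + 1; pose h := d / 2 / N.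
have N0 : 0 < N by rewrite /N ltr_wpDl ?addr_ge0.
have h0 : 0 < h by rewrite /h !divr_gt0.
have near_x s r : 0 <= s <= h -> 0 <= r <= h -> ball x d (x + s *: v + r *: w).
  move=> /andP[s0 sh] /andP[r0 rh].
  rewrite -ball_normE /ball_ /=.
  rewrite -addrA opprD addrA subrr add0r normrN.
  apply: (le_lt_trans (ler_normD _ _)); rewrite !normrZ !ger0_norm //.
  have : h * N < d by rewrite /h divfK ?gt_eqF //; lra.
  have := (ler_wpM2r (normr_ge0 v) sh, ler_wpM2r (normr_ge0 w) rh).
  by rewrite /N => -[]; lra.
have [|s [r [sh rh E]]] := @second_difference f x v w h h0.
  move=> s r sh rh; have [[dv _ dvw _] _ _] := bd _ (near_x _ _ sh rh).
  by split; [exact: dv|exact: dvw].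
have [|r' [s' [rh' sh' E']]] := @second_difference f x w v h h0.
  move=> s' r' sh' rh'; rewrite addrAC.
  have [[_ dw _ dwv] _ _] := bd _ (near_x _ _ rh' sh').
  by split; [exact: dw|exact: dwv].
have {}E' : f (x + h *: v + h *: w) - f (x + h *: v) - (f (x + h *: w) - f x)
    = h * (h * 'D_v ('D_w f) (x + s' *: v + r' *: w)).
  by rewrite (addrAC _ _ (r' *: w)) -E' (addrAC x (h *: w)) !opprB; ring.
have [_ xp _] := bd _ (near_x _ _ sh rh).
have [_ _ xq] := bd _ (near_x _ _ sh' rh').
have hI := mulfI (lt0r_neq0 h0).
exact: dist_le_of_common_value xp xq (hI _ _ (hI _ _ (etrans (esym E) E'))).
Qed.
End Schwarz.

(** * Derivatives of matrix fields *)

Section MatrixEntries.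
Variables (R : pzRingType) (m n : nat).
Implicit Types A B : 'M[R]_(m, n).

Lemma addmxE A B i j : (A + B) i j = A i j + B i j. Proof. exact: mxE. Qed.
Lemma oppmxE A i j : (- A) i j = - A i j. Proof. exact: mxE. Qed.
Lemma scalemxE k A i j : (k *: A) i j = k * A i j. Proof. exact: mxE. Qed.

Lemma zeromxE i j : (0 : 'M[R]_(m, n)) i j = 0. Proof. exact: mxE. Qed.
Lemma trmxD A B : (A + B)^T = A^T + B^T. Proof. exact: raddfD. Qed.
Lemma trmxN A : (- A)^T = - A^T. Proof. exact: raddfN. Qed.
Lemma rowD A B k : row k (A + B) = row k A + row k B. Proof. exact: raddfD. Qed.
Lemma rowN A k : row k (- A) = - row k A. Proof. exact: raddfN. Qed.

Definition entryE := (addmxE, oppmxE, scalemxE, zeromxE).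
End MatrixEntries.

Section MatrixDerivatives.
Variables (R : realType) (V : normedModType R).
Implicit Types (x v : V).

Lemma is_derive_mxP m n (A : V -> 'M[R]_(m, n)) x v dA :
  is_derive x v A dA <->
  forall i j, is_derive x v (fun y => A y i j) (dA i j).
Proof.
split=> [[dAx <-] i j|dAx].
  apply: DeriveDef; first by move/derivable_mxP : dAx.
  by rewrite derive_mx // mxE.
have dA' : derivable A x v.
  by apply/derivable_mxP => i j; have [] := dAx i j.
apply: DeriveDef => //; rewrite derive_mx //; apply/matrixP => i j.
by rewrite mxE; have [] := dAx i j.
Qed.

Lemma is_derive_mulmx m n p (A : V -> 'M[R]_(m, n)) (B : V -> 'M[R]_(n, p))
    x v dA dB : is_derive x v A dA -> is_derive x v B dB ->
  is_derive x v (fun y => A y *m B y) (dA *m B x + A x *m dB).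
Proof.
move=> /is_derive_mxP hA /is_derive_mxP hB; apply/is_derive_mxP => i j.
have -> : (fun y => (A y *m B y) i j) =
    \sum_(k < n) ((fun y => A y i k) * (fun y => B y k j)).
  by apply/funext => y; rewrite mxE fct_sumE.
have h k : is_derive x v ((fun y => A y i k) * (fun y => B y k j))
    (dA i k * B x k j + A x i k * dB k j).
  by apply: is_derive_eq; rewrite /GRing.scale /=; ring.
rewrite !mxE -big_split /=.
exact: is_derive_sum.
Qed.

Lemma is_derive_trmx m n (A : V -> 'M[R]_(m, n)) x v dA :
  is_derive x v A dA -> is_derive x v (fun y => (A y)^T) dA^T.
Proof.
move=> /is_derive_mxP hA; apply/is_derive_mxP => i j.
by under eq_fun do rewrite mxE; rewrite mxE.
Qed.

Lemma is_derive_row m n (A : V -> 'M[R]_(m, n)) x v dA k :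
  is_derive x v A dA -> is_derive x v (fun y => row k (A y)) (row k dA).
Proof.
move=> /is_derive_mxP hA; apply/is_derive_mxP => i j.
by under eq_fun do rewrite mxE; rewrite mxE.
Qed.

Lemma is_derive_scalemx m n (f : V -> R) (A : V -> 'M[R]_(m, n)) x v df dA :
  is_derive x v f df -> is_derive x v A dA ->
  is_derive x v (fun y => f y *: A y) (df *: A x + f x *: dA).
Proof.
move=> hf /is_derive_mxP hA; apply/is_derive_mxP => i j.
have -> : (fun y => (f y *: A y) i j) = (f * (fun y => A y i j)).
  by apply/funext => y; rewrite mxE.
by apply: is_derive_eq; rewrite !mxE /GRing.scale /=; ring.
Qed.

Lemma near_is_derive (W : normedModType R) (f h : V -> W) x v df :
  (\forall y \near x, f y = h y) -> is_derive x v h df -> is_derive x v f df.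
Proof.
move=> fh; apply: near_eq_is_derive; exact: filterS fh => y ->.
Qed.

Lemma is_derive_unique (W : normedModType R) (f : V -> W) x v a b :
  is_derive x v f a -> is_derive x v f b -> a = b.
Proof. by move=> [_ <-] [_ <-]. Qed.

End MatrixDerivatives.

(** * Curvature of connection matrices *)

(** A, B and C stand for the connection matrices in the coordinate directions a, b
    and c, and dAb for the derivative of A in the direction b; all of them are
    free matrices here.  The curvature matrix is dBa - dAb + B A - A B, since
    matrices act on row vectors from the right. *)
Section CurvatureMatrixAlgebra.
Variables (R : realFieldType) (m : nat).
Implicit Types A B dAb dBa G : 'M[R]_m.

Lemma skew_curvature_identity A B dAb dBa :
  dAb - dBa + A *m B - B *m A = - (dBa - dAb + B *m A - A *m B).
Proof. by apply/matrixP => i j; rewrite !entryE; lra. Qed.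

(** The hypothesis equates the two mixed derivatives of a parallel metric. *)
Lemma metric_curvature_identity A B dAb dBa G :
  dAb *m G + A *m (B *m G + G *m B^T)
    + ((B *m G + G *m B^T) *m A^T + G *m dAb^T) =
  dBa *m G + B *m (A *m G + G *m A^T)
    + ((A *m G + G *m A^T) *m B^T + G *m dBa^T) ->
  (dBa - dAb + B *m A - A *m B) *m G + G *m (dBa - dAb + B *m A - A *m B)^T = 0.
Proof.
move=> /matrixP E; apply/matrixP => i j; move: (E i j).
rewrite !(trmxD, trmxN) !trmx_mul !(mulmxDl, mulmxDr, mulNmx, mulmxN).
rewrite !mulmxA !entryE; lra.
Qed.

(** The hypothesis equates the two mixed derivatives of a parallel 1-form. *)
Lemma parallel_curvature_identity A B dAb dBa (t : 'cV[R]_m) :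
  dAb *m t + A *m (B *m t) = dBa *m t + B *m (A *m t) ->
  (dBa - dAb + B *m A - A *m B) *m t = 0.
Proof.
move=> /matrixP E; apply/matrixP => i j; move: (E i j).
by rewrite !(mulmxDl, mulNmx) !mulmxA !entryE; lra.
Qed.

Lemma comm_curvature_identity A B dAb dBa K :
  A *m K = K *m A -> B *m K = K *m B ->
  dAb *m K = K *m dAb -> dBa *m K = K *m dBa ->
  (dBa - dAb + B *m A - A *m B) *m K = K *m (dBa - dAb + B *m A - A *m B).
Proof.
move=> AK BK dAK dBK; rewrite !(mulmxDl, mulmxDr, mulNmx, mulmxN) dAK dBK.
by rewrite -!mulmxA AK BK !mulmxA AK BK.
Qed.

Lemma bianchi_curvature_identity (A B C dAb dAc dBa dBc dCa dCb : 'M[R]_m) a b c :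
  row c B = row b C -> row a C = row c A -> row b A = row a B ->
  row c dBa = row b dCa -> row a dCb = row c dAb -> row b dAc = row a dBc ->
  row c (dBa - dAb + B *m A - A *m B) + row a (dCb - dBc + C *m B - B *m C)
    + row b (dAc - dCa + A *m C - C *m A) = 0.
Proof.
move=> h1 h2 h3 h4 h5 h6; rewrite !(rowD, rowN) !row_mul h1 h2 h3 h4 h5 h6.
by apply/matrixP => i j; rewrite !entryE; lra.
Qed.

End CurvatureMatrixAlgebra.

Section SmoothMatrixFields.
Variables (R : realType) (m : nat) (U : set 'rV[R]_m).
Hypothesis U_open : open U.
Local Notation e_ a := (delta_mx (0 : 'I_1) (a : 'I_m) : 'rV[R]_m).

Lemma near_open x : U x -> \forall y \near x, U y.
Proof. by move=> Ux; apply: open_nbhs_nbhs. Qed.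

Definition smooth_mx p q (F : 'rV[R]_m -> 'M[R]_(p, q)) :=
  forall i j, smooth_on U (fun x => F x i j).

Lemma smooth_mx_is_derive p q (F : 'rV[R]_m -> 'M[R]_(p, q)) x a :
  smooth_mx F -> U x -> is_derive x (e_ a) F ('D_(e_ a) F x).
Proof.
move=> sF Ux; apply: derivableP; apply/derivable_mxP => i j.
by have [_ /(_ a)] := sF i j [::] x Ux.
Qed.

Lemma smooth_on_partial_comm f x a b : smooth_on U f -> U x ->
  partial a (partial b f) x = partial b (partial a f) x.
Proof.
move=> sf Ux; apply: derive_comm.
- apply: filterS (near_open Ux) => y Uy.
  have [_ d0] := sf [::] y Uy; have [_ da] := sf [:: a] y Uy.
  have [_ db] := sf [:: b] y Uy.
  by split; [exact: d0|exact: d0|exact: db|exact: da].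
- by have [] := sf [:: a; b] x Ux.
- by have [] := sf [:: b; a] x Ux.
Qed.

Lemma smooth_mx_second p q (F : 'rV[R]_m -> 'M[R]_(p, q)) x a b :
  smooth_mx F -> U x ->
  is_derive x (e_ a) ('D_(e_ b) F)
    (\matrix_(i, j) partial a (partial b (fun y => F y i j)) x).
Proof.
move=> sF Ux.
have E : \forall y \near x, 'D_(e_ b) F y =
    \matrix_(i, j) partial b (fun z => F z i j) y.
  apply: filterS (near_open Ux) => y Uy.
  by rewrite derive_mx //; have [] := smooth_mx_is_derive b sF Uy.
apply: near_is_derive E _; apply/is_derive_mxP => i j.
under eq_fun do rewrite mxE; rewrite mxE.
by apply: derivableP; have [_] := sF i j [:: b] x Ux.
Qed.

(** Symmetry of second derivatives for a field F whose first derivatives dF are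
    given by a formula on U: then dab and dba can be computed by the product
    rule. *)
Lemma smooth_mx_derive_comm p q (F : 'rV[R]_m -> 'M[R]_(p, q))
    (dF : 'I_m -> 'rV[R]_m -> 'M[R]_(p, q)) x a b dab dba :
  smooth_mx F -> (forall y, U y -> forall a, 'D_(e_ a) F y = dF a y) -> U x ->
  is_derive x (e_ a) (dF b) dab -> is_derive x (e_ b) (dF a) dba -> dab = dba.
Proof.
move=> sF FdF Ux hab hba.
have near_dF c : \forall y \near x, 'D_(e_ c) F y = dF c y.
  by apply: filterS (near_open Ux) => y /FdF.
have E c d dcd (h : is_derive x (e_ c) (dF d) dcd) : dcd =
    \matrix_(i, j) partial c (partial d (fun y => F y i j)) x.
  exact: is_derive_unique (near_is_derive (near_dF d) h)
    (smooth_mx_second c d sF Ux).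
rewrite (E _ _ _ hab) (E _ _ _ hba).
apply/matrixP => i j; rewrite [LHS]mxE [RHS]mxE.
exact: (smooth_on_partial_comm a b (sF i j) Ux).
Qed.

Section ConnectionMatrices.
Implicit Types Gam : 'I_m -> 'rV[R]_m -> 'M[R]_m.

(** Row c of [curv_mx Gam a b x] is the vector R_ab d_c. *)
Definition curv_mx Gam a b x : 'M[R]_m :=
  'D_(e_ a) (Gam b) x - 'D_(e_ b) (Gam a) x
  + Gam b x *m Gam a x - Gam a x *m Gam b x.

Definition derivable_conn Gam :=
  forall x, U x -> forall a b, derivable (Gam b) x (e_ a).

Lemma derivable_conn_is_derive Gam x a b : derivable_conn Gam -> U x ->
  is_derive x (e_ a) (Gam b) ('D_(e_ a) (Gam b) x).
Proof. by move=> dG Ux; apply: derivableP; apply: dG. Qed.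

Lemma curv_mx_skew Gam a b x : curv_mx Gam b a x = - curv_mx Gam a b x.
Proof. exact: skew_curvature_identity. Qed.

Section Metric.
Variables (Gam : 'I_m -> 'rV[R]_m -> 'M[R]_m) (G : 'rV[R]_m -> 'M[R]_m).
Hypothesis dGam : derivable_conn Gam.
Hypothesis G_smooth : smooth_mx G.
Hypothesis G_parallel : forall y, U y -> forall a,
  'D_(e_ a) G y = Gam a y *m G y + G y *m (Gam a y)^T.

Lemma is_derive_metric x a : U x ->
  is_derive x (e_ a) G (Gam a x *m G x + G x *m (Gam a x)^T).
Proof. by move=> Ux; rewrite -G_parallel //; apply: smooth_mx_is_derive. Qed.

Lemma curv_mx_metric x a b : U x ->
  curv_mx Gam a b x *m G x + G x *m (curv_mx Gam a b x)^T = 0.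
Proof.
move=> Ux.
have dG c d := is_deriveD
  (is_derive_mulmx (derivable_conn_is_derive d c dGam Ux)
     (is_derive_metric d Ux))
  (is_derive_mulmx (is_derive_metric d Ux)
     (is_derive_trmx (derivable_conn_is_derive d c dGam Ux))).
apply: metric_curvature_identity.
exact: (smooth_mx_derive_comm G_smooth G_parallel Ux (dG a b) (dG b a)).
Qed.

Variable th : 'rV[R]_m -> 'cV[R]_m.
Hypothesis th_smooth : smooth_mx th.
Hypothesis th_parallel : forall y, U y -> forall a,
  'D_(e_ a) th y = Gam a y *m th y.

Lemma is_derive_parallel x a : U x -> is_derive x (e_ a) th (Gam a x *m th x).
Proof. by move=> Ux; rewrite -th_parallel //; apply: smooth_mx_is_derive. Qed.

Lemma curv_mx_parallel x a b : U x -> curv_mx Gam a b x *m th x = 0.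
Proof.
move=> Ux.
have dth c d : is_derive x (e_ d) (fun y => Gam c y *m th y)
    ('D_(e_ d) (Gam c) x *m th x + Gam c x *m (Gam d x *m th x)).
  apply: is_derive_mulmx (derivable_conn_is_derive _ _ dGam Ux) _.
  exact: is_derive_parallel.
apply: parallel_curvature_identity.
exact: (smooth_mx_derive_comm th_smooth th_parallel Ux (dth a b) (dth b a)).
Qed.

End Metric.

Lemma curv_mx_comm Gam (K : 'M[R]_m) x a b : derivable_conn Gam ->
  (forall y, U y -> forall a, Gam a y *m K = K *m Gam a y) -> U x ->
  curv_mx Gam a b x *m K = K *m curv_mx Gam a b x.
Proof.
move=> dG GK Ux.
have DK c d : 'D_(e_ d) (Gam c) x *m K = K *m 'D_(e_ d) (Gam c) x.
  have h := derivable_conn_is_derive d c dG Ux.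
  have hK : is_derive x (e_ d) (fun=> K) 0 by apply: is_derive_cst.
  have E : \forall y \near x, Gam c y *m K = K *m Gam c y.
    by apply: filterS (near_open Ux) => y /GK.
  have := is_derive_unique (is_derive_mulmx h hK)
    (near_is_derive E (is_derive_mulmx hK h)).
  by rewrite mulmx0 addr0 mul0mx add0r.
exact: comm_curvature_identity (GK x Ux a) (GK x Ux b) (DK _ _) (DK _ _).
Qed.

Lemma curv_mx_bianchi Gam x a b c : derivable_conn Gam ->
  (forall y, U y -> forall a b, row a (Gam b y) = row b (Gam a y)) -> U x ->
  row c (curv_mx Gam a b x) + row a (curv_mx Gam b c x)
    + row b (curv_mx Gam c a x) = 0.
Proof.
move=> dG Gs Ux.
have Ds d a' b' : row a' ('D_(e_ d) (Gam b') x) = row b' ('D_(e_ d) (Gam a') x).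
  have h c' := derivable_conn_is_derive d c' dG Ux.
  have E : \forall y \near x, row a' (Gam b' y) = row b' (Gam a' y).
    by apply: filterS (near_open Ux) => y /Gs.
  exact: is_derive_unique (is_derive_row a' (h b'))
    (near_is_derive E (is_derive_row b' (h a'))).
exact: bianchi_curvature_identity (Gs x Ux _ _) (Gs x Ux _ _) (Gs x Ux _ _)
  (Ds _ _ _) (Ds _ _ _) (Ds _ _ _).
Qed.

End ConnectionMatrices.
End SmoothMatrixFields.

(** * Change of connection *)

Section ChangeOfConnectionAlgebra.
Variables (R : realFieldType) (m : nat).
Implicit Types A B G X K P Q : 'M[R]_m.

(** The tensor g(E(d_a) d_b, d_c) = - 1/2 (t_a g_bc + t_b g_ac - g_ab t_c), as a
    matrix in (b, c). *)
Definition weyl_low (t : 'cV[R]_m) G a : 'M[R]_m :=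
  - (1 / 2) *: (t a 0 *: G + t *m row a G - (row a G)^T *m t^T).

Lemma weyl_lowE (t : 'cV[R]_m) G a b c : weyl_low t G a b c =
  - (1 / 2) * (t a 0 * G b c + t b 0 * G a c - G a b * t c 0).
Proof. by rewrite /weyl_low !entryE !mxE !big_ord1 !mxE. Qed.

Definition weyl_low_deriv (t dt : 'cV[R]_m) G dG a : 'M[R]_m :=
  - (1 / 2) *: (dt a 0 *: G + t a 0 *: dG + (dt *m row a G + t *m row a dG)
    - ((row a dG)^T *m t^T + (row a G)^T *m dt^T)).

(** For parallel t and G the covariant derivative of the lowered tensor in the
    direction a reduces to the term in which it acts on the index b.  That term
    depends on row b of A only, so for a torsion-free connection it is symmetric in
    a and b, and drops out of the curvature. *)
Lemma weyl_low_deriv_parallel (t : 'cV[R]_m) G A b :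
  weyl_low_deriv t (A *m t) G (A *m G + G *m A^T) b =
  A *m weyl_low t G b + weyl_low t G b *m A^T
  - (1 / 2) *: ((row b A *m t) 0 0 *: G + t *m (row b A *m G)
      - (row b A *m G)^T *m t^T).
Proof.
have -> : (row b A *m t) 0 0 = (A *m t) b 0 by rewrite -row_mul mxE.
rewrite /weyl_low_deriv /weyl_low.
rewrite !(mulmxDl, mulmxDr, mulNmx, mulmxN, rowD, trmxD, trmxN).
rewrite -!scalemxAl -!scalemxAr.
rewrite !(mulmxDl, mulmxDr, mulNmx, mulmxN, trmx_mul, row_mul, trmxK).
rewrite -!scalemxAl -!scalemxAr !mulmxA.
by apply/matrixP => i j; rewrite !entryE; lra.
Qed.

(** Write E = A' - A and F = B' - B.  The hypotheses say that the covariant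
    derivatives of F along a and of E along b, lowered by G, are both - X, so
    that only the commutator of E and F remains. *)
Lemma conformal_change_identity A B A' B' G dAb dBa dAb' dBa' X :
  (dBa' - dBa) *m G + (B' - B) *m (A *m G + G *m A^T) =
    A *m ((B' - B) *m G) + (B' - B) *m G *m A^T - X ->
  (dAb' - dAb) *m G + (A' - A) *m (B *m G + G *m B^T) =
    B *m ((A' - A) *m G) + (A' - A) *m G *m B^T - X ->
  (dBa' - dAb' + B' *m A' - A' *m B') *m G =
  (dBa - dAb + B *m A - A *m B) *m G
  + (B' - B) *m (A' - A) *m G - (A' - A) *m (B' - B) *m G.
Proof.
move=> /matrixP H1 /matrixP H2; apply/matrixP => i j.
move: (H1 i j) (H2 i j).
rewrite !(mulmxDl, mulmxDr, mulNmx, mulmxN) !mulmxA !entryE; lra.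
Qed.

Lemma commuting_shift_identity A B P Q dAb dBa dPb dQa :
  A *m Q = Q *m A -> B *m P = P *m B -> P *m Q = Q *m P ->
  (dBa + dQa) - (dAb + dPb) + (B + Q) *m (A + P) - (A + P) *m (B + Q) =
  (dBa - dAb + B *m A - A *m B) + (dQa - dPb).
Proof.
move=> AQ BP PQ; apply/matrixP => i j.
rewrite !(mulmxDl, mulmxDr) AQ BP PQ !entryE; lra.
Qed.

Lemma unshift_curvature_identity A B P Q K G k :
  (A + (1 / 2) *: (k *: K)) *m G = B *m G + P *m Q *m G - Q *m P *m G ->
  A *m G = B *m G + (P *m Q - Q *m P) *m G - (1 / 2) *: (k *: (K *m G)).
Proof.
by rewrite mulmxBl addrA => <-; rewrite mulmxDl -!scalemxAl addrK.
Qed.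

(** Weyl connection minus Chern connection, in the direction a. *)
Definition weyl_shift K a (t : 'cV[R]_m) : 'M[R]_m :=
  - (1 / 2) *: (t a 0 *: 1%:M - (K *m t) a 0 *: K).

Lemma weyl_shift_comm K a t A : A *m K = K *m A ->
  A *m weyl_shift K a t = weyl_shift K a t *m A.
Proof.
move=> AK; rewrite /weyl_shift -scalemxAl -scalemxAr mulmxBl mulmxBr.
by rewrite -!scalemxAl -!scalemxAr AK mulmx1 mul1mx.
Qed.

End ChangeOfConnectionAlgebra.

Section ChangeOfConnection.
Variables (R : realType) (m : nat) (U : set 'rV[R]_m).
Hypothesis U_open : open U.
Local Notation e_ a := (delta_mx (0 : 'I_1) (a : 'I_m) : 'rV[R]_m).
Variables (Gam : 'I_m -> 'rV[R]_m -> 'M[R]_m).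
Variables (G : 'rV[R]_m -> 'M[R]_m) (th : 'rV[R]_m -> 'cV[R]_m).
Hypothesis dGam : derivable_conn U Gam.
Hypothesis Gam_sym :
  forall y, U y -> forall a b, row a (Gam b y) = row b (Gam a y).
Hypothesis G_deriv : forall y, U y -> forall a,
  is_derive y (e_ a) G (Gam a y *m G y + G y *m (Gam a y)^T).
Hypothesis th_deriv : forall y, U y -> forall a,
  is_derive y (e_ a) th (Gam a y *m th y).

Lemma is_derive_weyl_low x a b : U x ->
  is_derive x (e_ a) (fun y => weyl_low (th y) (G y) b)
    (weyl_low_deriv (th x) (Gam a x *m th x) (G x)
       (Gam a x *m G x + G x *m (Gam a x)^T) b).
Proof.
move=> Ux; have hG := G_deriv Ux a; have ht := th_deriv Ux a.
have htb : is_derive x (e_ a) (fun y => th y b 0) ((Gam a x *m th x) b 0).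
  by move/is_derive_mxP : ht; apply.
rewrite /weyl_low /weyl_low_deriv.
apply: is_deriveZ; apply: is_deriveB.
  apply: is_deriveD; first exact: is_derive_scalemx.
  exact: is_derive_mulmx ht (is_derive_row b hG).
exact: is_derive_mulmx (is_derive_trmx (is_derive_row b hG)) (is_derive_trmx ht).
Qed.

(** The difference of the connections is prescribed only after lowering an index
    by G, so that no inverse of G is differentiated. *)
Lemma curv_mx_conformal Gam' x a b : derivable_conn U Gam' ->
  (forall y, U y -> forall a,
     (Gam' a y - Gam a y) *m G y = weyl_low (th y) (G y) a) -> U x ->
  let E a := Gam' a x - Gam a x in
  curv_mx Gam' a b x *m G x =
  curv_mx Gam a b x *m G x + E b *m E a *m G x - E a *m E b *m G x.
Proof.
move=> dGam' Gam'E Ux.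
pose X c d := (1 / 2) *: ((row d (Gam c x) *m th x) 0 0 *: G x
  + th x *m (row d (Gam c x) *m G x) - (row d (Gam c x) *m G x)^T *m (th x)^T).
have H c d : ('D_(e_ c) (Gam' d) x - 'D_(e_ c) (Gam d) x) *m G x
    + (Gam' d x - Gam d x) *m (Gam c x *m G x + G x *m (Gam c x)^T) =
    Gam c x *m ((Gam' d x - Gam d x) *m G x)
    + (Gam' d x - Gam d x) *m G x *m (Gam c x)^T - X c d.
  have dE : is_derive x (e_ c) (fun y => Gam' d y - Gam d y)
      ('D_(e_ c) (Gam' d) x - 'D_(e_ c) (Gam d) x).
    exact: is_deriveB (derivable_conn_is_derive c d dGam' Ux)
      (derivable_conn_is_derive c d dGam Ux).
  have near_E : \forall y \near x,
      (Gam' d y - Gam d y) *m G y = weyl_low (th y) (G y) d.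
    by apply: filterS (near_open U_open Ux) => y /Gam'E.
  rewrite Gam'E // -weyl_low_deriv_parallel.
  exact: is_derive_unique (is_derive_mulmx dE (G_deriv Ux c))
    (near_is_derive near_E (is_derive_weyl_low c d Ux)).
have Hba := H b a; rewrite /X (Gam_sym Ux a b) -/(X a b) in Hba.
exact: conformal_change_identity (H a b) Hba.
Qed.

Variable K : 'M[R]_m.

Lemma is_derive_weyl_shift x a b : U x ->
  is_derive x (e_ a) (fun y => weyl_shift K b (th y))
    (weyl_shift K b (Gam a x *m th x)).
Proof.
move=> Ux; have ht := th_deriv Ux a.
have hK : is_derive x (e_ a) (fun=> K) 0 by apply: is_derive_cst.
have h1 : is_derive x (e_ a) (fun=> 1%:M : 'M[R]_m) 0 by apply: is_derive_cst.
have hKt := is_derive_mulmx hK ht.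
rewrite mul0mx add0r in hKt.
move/is_derive_mxP : (ht) => /(_ b 0) htb.
move/is_derive_mxP : (hKt) => /(_ b 0) hKtb.
have := is_deriveB (is_derive_scalemx htb h1) (is_derive_scalemx hKtb hK).
rewrite !scaler0 !addr0; exact: is_deriveZ.
Qed.

(** The shift is a combination of 1 and K, which commute with GamD, so only its
    exterior derivative survives; the part along 1 is the exterior derivative of
    th, which is closed because it is parallel for the torsion-free Gam. *)
Lemma curv_mx_shift GamD x a b : derivable_conn U GamD ->
  (forall y, U y -> forall a, GamD a y *m K = K *m GamD a y) -> U x ->
  curv_mx (fun a y => GamD a y + weyl_shift K a (th y)) a b x =
  curv_mx GamD a b x
  + (1 / 2) *: (((K *m (Gam a x *m th x)) b 0
                 - (K *m (Gam b x *m th x)) a 0) *: K).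
Proof.
move=> dGD GDK Ux.
have D c d : 'D_(e_ c) (fun y => GamD d y + weyl_shift K d (th y)) x =
    'D_(e_ c) (GamD d) x + weyl_shift K d (Gam c x *m th x).
  exact: (@derive_val _ _ _ _ _ _ _
    (is_deriveD (derivable_conn_is_derive c d dGD Ux) (is_derive_weyl_shift c d Ux))).
rewrite {1}/curv_mx !D commuting_shift_identity //.
- congr (_ + _); rewrite /weyl_shift.
  have -> : (Gam a x *m th x) b 0 = (Gam b x *m th x) a 0.
    by have := congr1 (fun r => (r *m th x) 0 0) (Gam_sym Ux a b);
      rewrite -!row_mul ![row _ _ _ _]mxE.
  by apply/matrixP => i j; rewrite !entryE; lra.
- exact: weyl_shift_comm (GDK x Ux a).
- exact: weyl_shift_comm (GDK x Ux b).
- by apply: weyl_shift_comm; rewrite weyl_shift_comm.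
Qed.

End ChangeOfConnection.

(** * Contraction of component families with vectors *)

Section Contractions.
Variables (R : realFieldType) (m : nat).
Local Notation e_ a := (delta_mx (0 : 'I_1) (a : 'I_m) : 'rV[R]_m).
Implicit Types (u v w : 'rV[R]_m) (F : 'I_m -> 'M[R]_m).

Lemma linear_ext (W : lmodType R) (f h : 'rV[R]_m -> W) :
  (forall k u v, f (k *: u + v) = k *: f u + f v) ->
  (forall k u v, h (k *: u + v) = k *: h u + h v) ->
  (forall a, f (e_ a) = h (e_ a)) -> forall u, f u = h u.
Proof.
move=> lf lh fh u.
have f0 : f 0 = 0 by have := lf (-1) 0 0; rewrite scaler0 addr0 scaleN1r addNr.
have h0 : h 0 = 0 by have := lh (-1) 0 0; rewrite scaler0 addr0 scaleN1r addNr.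
rewrite (row_sum_delta u); elim/big_rec : _ => [|a y _ IH]; first by rewrite f0.
by rewrite lf lh fh IH.
Qed.

(** The component family F contracted with u in the direction index: for the
    connection matrices, z *m along F u is the covariant derivative along u of the
    constant field z. *)
Definition along F u : 'M[R]_m := \sum_a u 0 a *: F a.

Lemma along_linear F k u v : along F (k *: u + v) = k *: along F u + along F v.
Proof.
rewrite /along scaler_sumr -big_split /=; apply: eq_bigr => a _.
by rewrite !mxE scalerDl scalerA.
Qed.

Lemma alongN F u : along F (- u) = - along F u.
Proof.
by rewrite /along -sumrN; apply: eq_bigr => a _; rewrite mxE scaleNr.
Qed.

Lemma along_delta F a : along F (e_ a) = F a.
Proof.
rewrite /along (bigD1 a) //= big1 => [|b /negPf ba].
  by rewrite mxE !eqxx scale1r addr0.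
by rewrite mxE ba andbF scale0r.
Qed.

Lemma along_ind (P : 'M[R]_m -> Prop) F u :
  P 0 -> (forall k A B, P A -> P B -> P (k *: A + B)) -> (forall a, P (F a)) ->
  P (along F u).
Proof. by move=> P0 PD PF; rewrite /along; elim/big_rec : _ => // a y _; apply: PD. Qed.

Lemma alongB F H u : along (fun a => F a - H a) u = along F u - along H u.
Proof. by rewrite /along -sumrB; apply: eq_bigr => a _; rewrite scalerBr. Qed.

Lemma along_skew (G : 'M[R]_m) F u :
  (forall a, F a *m G + G *m (F a)^T = 0) ->
  along F u *m G + G *m (along F u)^T = 0.
Proof.
move=> FG; apply: (along_ind (P := fun A => A *m G + G *m A^T = 0)) => // [|k A B hA hB].
  by rewrite trmx0 mul0mx mulmx0 addr0.
rewrite linearP /= mulmxDl mulmxDr -scalemxAl -scalemxAr addrACA -scalerDr.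
by rewrite hA hB scaler0 addr0.
Qed.

Lemma along_comm (K : 'M[R]_m) F u :
  (forall a, F a *m K = K *m F a) -> along F u *m K = K *m along F u.
Proof.
move=> FK; apply: (along_ind (P := fun A => A *m K = K *m A)) => //.
  by rewrite mul0mx mulmx0.
by move=> k A B AK BK; rewrite mulmxDl mulmxDr -scalemxAl -scalemxAr AK BK.
Qed.

Lemma along_kill (t : 'cV[R]_m) F u :
  (forall a, F a *m t = 0) -> along F u *m t = 0.
Proof.
move=> Ft; apply: (along_ind (P := fun A => A *m t = 0)) => //.
  by rewrite mul0mx.
by move=> k A B hA hB; rewrite mulmxDl -scalemxAl hA hB scaler0 addr0.
Qed.

Definition along2 (F : 'I_m -> 'I_m -> 'M[R]_m) u v : 'M[R]_m :=
  along (fun a => along (F a) v) u.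

Lemma along2_linearl (F : 'I_m -> 'I_m -> 'M[R]_m) k u u' v :
  along2 F (k *: u + u') v = k *: along2 F u v + along2 F u' v.
Proof. exact: along_linear. Qed.

Lemma along2_linearr (F : 'I_m -> 'I_m -> 'M[R]_m) k u v v' :
  along2 F u (k *: v + v') = k *: along2 F u v + along2 F u v'.
Proof.
have alongE H : along H u = \sum_a u 0 a *: H a by [].
rewrite /along2 !alongE scaler_sumr -big_split /=; apply: eq_bigr => a _.
by rewrite along_linear scalerDr !scalerA mulrC.
Qed.

Lemma along2_delta (F : 'I_m -> 'I_m -> 'M[R]_m) a b : along2 F (e_ a) (e_ b) = F a b.
Proof. by rewrite /along2 !along_delta. Qed.

Lemma along2_ext (W : lmodType R) (f h : 'rV[R]_m -> 'rV[R]_m -> W) :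
  (forall k u u' v, f (k *: u + u') v = k *: f u v + f u' v) ->
  (forall k u u' v, h (k *: u + u') v = k *: h u v + h u' v) ->
  (forall k u v v', f u (k *: v + v') = k *: f u v + f u v') ->
  (forall k u v v', h u (k *: v + v') = k *: h u v + h u v') ->
  (forall a b, f (e_ a) (e_ b) = h (e_ a) (e_ b)) -> forall u v, f u v = h u v.
Proof.
move=> fl hl fr hr fh u v; apply: (linear_ext (f := f ^~ v) (h := h ^~ v)) => //.
by move=> a; apply: (linear_ext (f := f (e_ a)) (h := h (e_ a))).
Qed.

Lemma along3_ext (W : lmodType R) (f h : 'rV[R]_m -> 'rV[R]_m -> 'rV[R]_m -> W) :
  (forall k u u' v w, f (k *: u + u') v w = k *: f u v w + f u' v w) ->
  (forall k u u' v w, h (k *: u + u') v w = k *: h u v w + h u' v w) ->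
  (forall k u v v' w, f u (k *: v + v') w = k *: f u v w + f u v' w) ->
  (forall k u v v' w, h u (k *: v + v') w = k *: h u v w + h u v' w) ->
  (forall k u v w w', f u v (k *: w + w') = k *: f u v w + f u v w') ->
  (forall k u v w w', h u v (k *: w + w') = k *: h u v w + h u v w') ->
  (forall a b c, f (e_ a) (e_ b) (e_ c) = h (e_ a) (e_ b) (e_ c)) ->
  forall u v w, f u v w = h u v w.
Proof.
move=> f1 h1 f2 h2 f3 h3 fh u v w.
apply: (along2_ext (f := fun u v => f u v w) (h := fun u v => h u v w)) => // a b.
by apply: (linear_ext (f := f (e_ a) (e_ b)) (h := h (e_ a) (e_ b))).
Qed.

Definition ip (G : 'M[R]_m) u v : R := (u *m G *m v^T) 0 0.

Lemma ip_linearl (G : 'M[R]_m) k u v w : ip G (k *: u + v) w = k * ip G u w + ip G v w.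
Proof. by rewrite /ip !mulmxDl -!scalemxAl !mxE. Qed.

Lemma ip_sym (G : 'M[R]_m) : G^T = G -> forall u v, ip G u v = ip G v u.
Proof.
move=> GT u v; rewrite /ip -[in LHS](trmxK (u *m G *m v^T)) mxE.
by rewrite !trmx_mul trmxK GT mulmxA.
Qed.

Lemma ip_delta (G : 'M[R]_m) a b : ip G (e_ a) (e_ b) = G a b.
Proof. by rewrite /ip -rowE trmx_delta -colE !mxE. Qed.

Lemma ip_mulmx_delta (G A : 'M[R]_m) b c : ip G (e_ b *m A) (e_ c) = (A *m G) b c.
Proof. by rewrite /ip -(mulmxA _ A); exact: ip_delta. Qed.

Lemma ip_eq0_mx (G A : 'M[R]_m) : G \in unitmx ->
  (forall z w, ip G (z *m A) w = 0) -> A = 0.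
Proof.
move=> Gu A0; have AG : A *m G = 0.
  by apply/matrixP => i j; have := A0 (e_ i) (e_ j); rewrite /ip -(mulmxA _ A) -rowE
    trmx_delta -colE !mxE.
by rewrite -[A](mulmxK Gu) AG mul0mx.
Qed.

Lemma pos_unitmx (G : 'M[R]_m) : (forall v, v != 0 -> 0 < ip G v v) -> G \in unitmx.
Proof.
move=> Gpos; rewrite -row_free_unit -kermx_eq0; apply/rowV0P => v.
move/sub_kermxP => vG; apply/eqP/negPn/negP => /Gpos.
by rewrite /ip vG mul0mx mxE ltxx.
Qed.

(** Two linear equations in more than two unknowns. *)
Lemma exists_orthogonal2 (p q : 'cV[R]_m) : (2 < m)%N ->
  exists y : 'rV[R]_m, [/\ y != 0, y *m p = 0 & y *m q = 0].
Proof.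
move=> m2; have : kermx (row_mx p q) != 0.
  rewrite -mxrank_eq0 mxrank_ker subn_eq0 -ltnNge.
  by apply: leq_ltn_trans (rank_leq_col _) _.
move/rowV0Pn => [y /sub_kermxP yN y0]; exists y; split=> //.
  by have := congr1 lsubmx yN; rewrite mul_mx_row row_mxKl linear0.
by have := congr1 rsubmx yN; rewrite mul_mx_row row_mxKr linear0.
Qed.

End Contractions.

(** * The pointwise theorem in a frame *)

(** All data are components at one point: Ar and AD are the connection matrices of
    the Levi-Civita and the Chern connection, dG the derivatives of G, and later Rr
    and RD the two curvatures. *)
Section PointwiseMatrices.
Variables (R : realType) (m : nat).
Local Notation e_ a := (delta_mx (0 : 'I_1) (a : 'I_m) : 'rV[R]_m).
Variables (G K : 'M[R]_m) (th : 'cV[R]_m) (Ar AD dG : 'I_m -> 'M[R]_m).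
Hypothesis G_tr : G^T = G.
Hypothesis G_pos : forall v : 'rV[R]_m, v != 0 -> 0 < (v *m G *m v^T) 0 0.
Hypothesis KK : K *m K = - 1%:M.
Hypothesis G_K : K *m G *m K^T = G.

Let g := ip G.
Let J : {linear 'rV[R]_m -> 'rV[R]_m} := mulmxr K.
Let t : 'rV[R]_m := th^T *m invmx G.

Let g_linear k u v w : g (k *: u + v) w = k * g u w + g v w.
Proof. exact: ip_linearl. Qed.
Let g_sym u v : g u v = g v u. Proof. exact: ip_sym. Qed.
Let g_pos u : u != 0 -> 0 < g u u. Proof. exact: G_pos. Qed.
Let JK u : J (J u) = - u.
Proof. by rewrite /J /= -mulmxA KK mulmxN mulmx1. Qed.
Let g_J u v : g (J u) (J v) = g u v.
Proof. by rewrite /g /ip /J /= trmx_mul !mulmxA -(mulmxA u) -(mulmxA u) G_K. Qed.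
Let G_unit : G \in unitmx. Proof. exact: pos_unitmx. Qed.
Let gE := (formDl g_linear, formDr g_linear g_sym, formZl g_linear, formZr g_linear g_sym,
  formNl g_linear, formNr g_linear g_sym).

Let g_linr k u1 u2 v : g v (k *: u1 + u2) = k * g v u1 + g v u2.
Proof. by rewrite !gE. Qed.

(** t is the Lee vector, dual to th. *)
Let gt u : g u t = (u *m th) 0 0.
Proof.
by rewrite /g /ip /t trmx_mul trmxK trmx_inv G_tr !mulmxA mulmxK.
Qed.

Let gt_delta a : g (e_ a) t = th a 0.
Proof. by rewrite gt -rowE !mxE. Qed.

Let lee_vector_matrix : t = 0 -> th = 0.
Proof.
move=> t0; apply/matrixP => a j; rewrite (ord1 j) mxE -gt_delta t0.
by rewrite g_sym (form0l g_linear).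
Qed.

Hypothesis Ar_sym : forall a b, row a (Ar b) = row b (Ar a).
Hypothesis Ar_metric : forall a, dG a = Ar a *m G + G *m (Ar a)^T.
Hypothesis AD_metric : forall a, dG a = AD a *m G + G *m (AD a)^T.
Hypothesis AD_K : forall a, AD a *m K = K *m AD a.
Hypothesis AD_torsion : forall u v,
  v *m along AD (u *m K) - (u *m K) *m along AD v =
  (v *m K) *m along AD u - u *m along AD (v *m K).
Hypothesis AD_lee : forall a b c,
  (K *m dG a) b c + (K *m dG b) c a + (K *m dG c) a b = wedge12 th (K *m G) a b c.

Let Gr u (v : 'rV[R]_m) := v *m along Ar u.
Let GD u (v : 'rV[R]_m) := v *m along AD u.

Let along_row_sym F : (forall a b, row a (F b) = row b (F a)) ->
  forall u v : 'rV[R]_m, v *m along F u = u *m along F v.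
Proof.
move=> Fs; apply: along2_ext => [k u u' v|k u u' v|k u v v'|k u v v'|a b].
- by rewrite along_linear mulmxDr -scalemxAr.
- by rewrite mulmxDl -scalemxAl.
- by rewrite mulmxDl -scalemxAl.
- by rewrite along_linear mulmxDr -scalemxAr.
- by rewrite !along_delta -!rowE.
Qed.

Let B_skew u v w : g (GD u v - Gr u v) w + g v (GD u w - Gr u w) = 0.
Proof.
pose M := along (fun a => AD a - Ar a) u.
have DB z : GD u z - Gr u z = z *m M by rewrite /GD /Gr -mulmxBr /M alongB.
have M_skew : M *m G + G *m M^T = 0.
  apply: along_skew => a; have := AD_metric a; rewrite Ar_metric => /matrixP E.
  apply/matrixP => i j; move: (E i j).
  by rewrite trmxD trmxN !(mulmxDl, mulmxDr, mulNmx, mulmxN) !entryE; lra.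
have : v *m (M *m G + G *m M^T) *m w^T = 0 by rewrite M_skew mulmx0 mul0mx.
rewrite !DB /g /ip trmx_mul !mulmxA mulmxDr mulmxDl !mulmxA.
by move/matrixP => /(_ 0 0); rewrite !entryE.
Qed.

Let GD_deriv u : along dG u = along AD u *m G + G *m (along AD u)^T.
Proof.
apply: (linear_ext (f := along dG)
  (h := fun u => along AD u *m G + G *m (along AD u)^T)) => [k a b|k a b|a].
- by rewrite along_linear.
- rewrite along_linear linearP /= mulmxDl mulmxDr -scalemxAl -scalemxAr.
  by rewrite scalerDr addrACA.
- by rewrite !along_delta AD_metric.
Qed.

Let T_lee u v w :
  g (J (GD u v - GD v u)) w + g (J (GD v w - GD w v)) u
    + g (J (GD w u - GD u w)) v =
  g u t * g (J v) w + g v t * g (J w) u + g w t * g (J u) v.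
Proof.
pose phi (u v w : 'rV[R]_m) : R := (v *m K *m along dG u *m w^T) 0 0.
have phi1 k (u1 u2 v' w' : 'rV[R]_m) : phi (k *: u1 + u2) v' w' = k * phi u1 v' w' + phi u2 v' w'.
  by rewrite /phi along_linear mulmxDr mulmxDl -scalemxAr -scalemxAl !mxE.
have phi2 k (u1 u2 v' w' : 'rV[R]_m) : phi v' (k *: u1 + u2) w' = k * phi v' u1 w' + phi v' u2 w'.
  by rewrite /phi !mulmxDl -!scalemxAl !mxE.
have phi3 k (u1 u2 v' w' : 'rV[R]_m) : phi v' w' (k *: u1 + u2) = k * phi v' w' u1 + phi v' w' u2.
  by rewrite /phi linearP /= mulmxDr -scalemxAr !mxE.
have phiE : phi u v w + phi v w u + phi w u v =
    g u t * g (J v) w + g v t * g (J w) u + g w t * g (J u) v.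
  move: u v w; apply: (along3_ext
    (f := fun u v w => phi u v w + phi v w u + phi w u v)
    (h := fun u v w => g u t * g (J v) w + g v t * g (J w) u + g w t * g (J u) v)).
  1,3,5: by move=> *; rewrite !(phi1, phi2, phi3) /GRing.scale /=; lra.
  1,2,3: by move=> *; rewrite !(linearP J) !(g_linear, g_linr) /GRing.scale /=; lra.
  have phiK a b c : phi (e_ a) (e_ b) (e_ c) = (K *m dG a) b c.
    by rewrite /phi along_delta -(mulmxA _ K); exact: ip_delta.
  have gK b c : g (J (e_ b)) (e_ c) = (K *m G) b c.
    by rewrite /g /ip /J /= -(mulmxA _ K); exact: ip_delta.
  by move=> a b c; rewrite !phiK AD_lee !gt_delta !gK.
have phiD u' v' w' : phi u' v' w' = g (J (GD u' v')) w' + g (J v') (GD u' w').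
  rewrite /phi GD_deriv /g /ip /J /GD /= trmx_mul mulmxDr mulmxDl mxE.
  congr (_ + _); last by rewrite !mulmxA.
  by rewrite -[in RHS](mulmxA v') (along_comm u' AD_K) !mulmxA.
rewrite -phiE !phiD !linearB !gE.
have gs := formJ_skew g_linear g_sym JK g_J.
by rewrite (gs (GD u w) v) (gs (GD v u) w) (gs (GD w v) u); lra.
Qed.

(** [chern_minus_levi_civita] in components. *)
Lemma weyl_shift_low a :
  (AD a + weyl_shift K a th - Ar a) *m G = weyl_low th G a.
Proof.
have GD_opp u v : GD (- u) v = - GD u v by rewrite /GD alongN mulmxN.
have GD_J u v : GD u (J v) = J (GD u v).
  by rewrite /GD /J /= -!mulmxA (along_comm u AD_K).
have := chern_minus_levi_civita g_linear g_sym g_pos JK g_J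
  (along_row_sym Ar_sym) GD_opp GD_J AD_torsion T_lee B_skew.
move=> H; apply/matrixP => b c; move: (H (e_ a) (e_ b) (e_ c)).
have gKt d : g (J (e_ d)) t = (K *m th) d 0.
  by rewrite gt /J /= -mulmxA -rowE mxE.
have gKe d e : g (J (e_ d)) (e_ e) = (K *m G) d e.
  by rewrite /g /ip /J /= -(mulmxA _ K); exact: ip_delta.
rewrite /GD /Gr !along_delta -mulmxBr /g ip_mulmx_delta -/g !gt_delta gKt gKe.
rewrite /g !ip_delta weyl_lowE /weyl_shift.
rewrite !(mulmxDl, mulNmx, scalerDr, scalerN) -!scalemxAl mul1mx !entryE; lra.
Qed.

Let E a := AD a + weyl_shift K a th - Ar a.

Lemma along_weyl_shift u z : z *m along E u = weyl_diff g t u z.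
Proof.
apply: (form_inj g_linear g_pos) => w; move: u z w; apply: (along3_ext
  (f := fun u z w => g (z *m along E u) w)
  (h := fun u z w => g (weyl_diff g t u z) w)).
- by move=> *; rewrite along_linear mulmxDr -scalemxAr g_linear.
- by move=> *; rewrite /weyl_diff !gE /GRing.scale /=; lra.
- by move=> *; rewrite mulmxDl -scalemxAl g_linear.
- by move=> *; rewrite /weyl_diff !gE /GRing.scale /=; lra.
- by move=> *; rewrite g_linr.
- by move=> *; rewrite g_linr.
move=> a b c; rewrite along_delta /weyl_diff !gE !gt_delta {1}/g ip_mulmx_delta.
by rewrite /E weyl_shift_low weyl_lowE (g_sym t) gt_delta /g !ip_delta; lra.
Qed.

Variables Rr RD : 'I_m -> 'I_m -> 'M[R]_m.
Hypothesis Rr_skew : forall a b, Rr b a = - Rr a b.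
Hypothesis Rr_metric : forall a b, Rr a b *m G + G *m (Rr a b)^T = 0.
Hypothesis Rr_bianchi : forall a b c,
  row c (Rr a b) + row a (Rr b c) + row b (Rr c a) = 0.
Hypothesis Rr_th : forall a b, Rr a b *m th = 0.
Hypothesis RD_K : forall a b, RD a b *m K = K *m RD a b.
Hypothesis RD_Rr : forall a b,
  RD a b *m G = Rr a b *m G + (E b *m E a - E a *m E b) *m G
  - (1 / 2) *: (((K *m (Ar a *m th)) b 0 - (K *m (Ar b *m th)) a 0) *: (K *m G)).

Let Rr4 u v z w : R := g (z *m along2 Rr u v) w.
Let RD4 u v z w : R := g (z *m along2 RD u v) w.

Let twist u v : R := (v *m K *m along Ar u *m th) 0 0 - (u *m K *m along Ar v *m th) 0 0.

(** In terms of the Weyl connection, twist only sees E: the Weyl connection is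
    symmetric and commutes with K, so its contribution to t(W_u(Jv)) - t(W_v(Ju))
    cancels. *)
Let twistE u v : twist u v = lee_twist g J t u v.
Proof.
pose W a := AD a + weyl_shift K a th.
have WK w : along W w *m K = K *m along W w.
  apply: along_comm => a; rewrite /W mulmxDl mulmxDr AD_K.
  by rewrite (weyl_shift_comm a th (erefl (K *m K))).
have ArE w z : z *m along Ar w = z *m along W w - weyl_diff g t w z.
  by rewrite -along_weyl_shift /E alongB mulmxBr opprB addrC subrK.
have W_sym w z : z *m along W w = w *m along W z.
  have := along_row_sym Ar_sym w z; rewrite !ArE (weyl_diff_sym g_sym t z w).
  exact: addIr.
have -> : twist u v = g (weyl_diff g t v (J u)) t - g (weyl_diff g t u (J v)) t.
  rewrite /twist !ArE !mulmxBl !entryE !gt.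
  rewrite -!(mulmxA _ K (along W _)) -!WK.
  rewrite !(mulmxA _ _ K) W_sym; lra.
rewrite !(weyl_diff_lee g_linear) /lee_twist.
rewrite (g_sym v (J u)) (formJl g_linear g_sym JK g_J u v); lra.
Qed.

Let twist_linearl k u1 u2 v : twist (k *: u1 + u2) v = k * twist u1 v + twist u2 v.
Proof.
rewrite /twist along_linear !(mulmxDl, mulmxDr) -!(scalemxAl, scalemxAr).
by rewrite !entryE; lra.
Qed.

Let twist_linearr k u v1 v2 : twist u (k *: v1 + v2) = k * twist u v1 + twist u v2.
Proof.
have tw x y : twist x y = - twist y x by rewrite /twist opprB.
by rewrite !(tw u) twist_linearl; lra.
Qed.

Let RD_along u v : along2 RD u v *m G = along2 Rr u v *m G
  + (along E v *m along E u - along E u *m along E v) *m G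
  - (1 / 2) *: (twist u v *: (K *m G)).
Proof.
move: u v; apply: (along2_ext (f := fun u v => along2 RD u v *m G)
  (h := fun u v => along2 Rr u v *m G
    + (along E v *m along E u - along E u *m along E v) *m G
    - (1 / 2) *: (twist u v *: (K *m G)))).
- by move=> *; rewrite along2_linearl mulmxDl -scalemxAl.
- move=> k u u' v; rewrite along2_linearl along_linear twist_linearl.
  rewrite !(mulmxDl, mulmxDr, mulNmx) -!(scalemxAl, scalemxAr).
  by apply/matrixP => i j; rewrite !entryE; lra.
- by move=> *; rewrite along2_linearr mulmxDl -scalemxAl.
- move=> k u v v'; rewrite along2_linearr along_linear twist_linearr.
  rewrite !(mulmxDl, mulmxDr, mulNmx) -!(scalemxAl, scalemxAr).
  by apply/matrixP => i j; rewrite !entryE; lra.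
move=> a b; rewrite !along2_delta !along_delta RD_Rr /twist !along_delta.
by rewrite -!mulmxA -!rowE ![row _ _ _ _]mxE.
Qed.

Let RD4_Rr4 u v z w : RD4 u v z w =
  Rr4 u v z w + weyl_corr g t u v z w - lee_twist g J t u v * g (J z) w / 2.
Proof.
rewrite -(weyl_diff_comm g_linear g_sym) -!along_weyl_shift -twistE.
rewrite /RD4 /Rr4 /g /ip /J /= -!(mulmxA z) -!(mulmxA _ _ G) RD_along.
rewrite !(mulmxDl, mulmxDr, mulNmx, mulmxN) -!(scalemxAl, scalemxAr) !mulmxA.
by rewrite !entryE; lra.
Qed.

Variable c : R.
Hypothesis m_gt2 : (2 < m)%N.
Hypothesis H : (forall u, RD4 u (J u) (J u) u = c * g u u ^+ 2) \/
  (forall u, Rr4 u (J u) (J u) u = c * g u u ^+ 2).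

Let Rr4_addl x x' y z w : Rr4 (x + x') y z w = Rr4 x y z w + Rr4 x' y z w.
Proof.
rewrite /Rr4 -[x in x + _]scale1r along2_linearl scale1r.
by rewrite mulmxDr gE.
Qed.

Let Rr4_skew12 x y z w : Rr4 y x z w = - Rr4 x y z w.
Proof.
suff E' : along2 Rr y x = - along2 Rr x y by rewrite /Rr4 E' mulmxN gE.
move: y x; apply: (along2_ext (f := fun y x => along2 Rr y x)
  (h := fun y x => - along2 Rr x y)) => [k u u' v|k u u' v|k u v v'|k u v v'|a b].
- exact: along2_linearl.
- by rewrite along2_linearr opprD scalerN.
- exact: along2_linearr.
- by rewrite along2_linearl opprD scalerN.
- by rewrite !along2_delta.
Qed.

Let Rr4_skew34 x y z w : Rr4 x y w z = - Rr4 x y z w.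
Proof.
have := along_skew x (fun a => along_skew y (Rr_metric a)).
move=> /(congr1 (fun A => (z *m A *m w^T) 0 0)).
rewrite mulmx0 mul0mx mulmxDr mulmxDl addmxE zeromxE /Rr4 /g.
rewrite (ip_sym G_tr (w *m _)) /ip trmx_mul !mulmxA; lra.
Qed.

Let Rr4_bianchi x y z w : Rr4 x y z w + Rr4 y z x w + Rr4 z x y w = 0.
Proof.
suff E' : z *m along2 Rr x y + x *m along2 Rr y z + y *m along2 Rr z x = 0.
  by rewrite /Rr4 -!(formDl g_linear) E' (form0l g_linear).
move: x y z; apply: (along3_ext
 (f := fun x y z => z *m along2 Rr x y + x *m along2 Rr y z + y *m along2 Rr z x)
 (h := fun x y z => 0)).
1,3,5: by move=> *;
  rewrite !(along2_linearl, along2_linearr, mulmxDl, mulmxDr);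
  rewrite -!(scalemxAl, scalemxAr);
  apply/matrixP => i j; rewrite !entryE; lra.
1,2,3: by move=> *; rewrite scaler0 addr0.
by move=> a b d; rewrite !along2_delta -!rowE Rr_bianchi.
Qed.

Let Rr4_lee x y z : Rr4 x y z t = 0.
Proof.
rewrite /Rr4 gt -mulmxA.
have -> := along_kill x (fun a => along_kill y (Rr_th a)).
by rewrite mulmx0 mxE.
Qed.

Let RD4_J x y z w : RD4 x y (J z) (J w) = RD4 x y z w.
Proof.
have RK := along_comm x (fun a => along_comm y (RD_K a)).
rewrite -[RHS]g_J; congr (g _ _).
by rewrite /J /= -!mulmxA RK.
Qed.

Lemma pointwise_const_hol_sec_curv :
  th = 0 /\ (c = 0 -> forall a b, RD a b = 0 /\ Rr a b = 0).
Proof.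
have [y [y0 y1 y2]] := exists_orthogonal2 th (G *m (t *m K)^T) m_gt2.
have yt : g y t = 0 by rewrite gt y1 mxE.
have yJt : g y (J t) = 0 by rewrite /g /ip /J /= -mulmxA y2 mxE.
split=> [|c0 a b].
  apply: lee_vector_matrix.
  exact: (const_hol_sec_curv_lee_vector g_linear g_sym g_pos JK g_J Rr4_addl
    Rr4_skew12 Rr4_skew34 Rr4_bianchi Rr4_lee RD4_Rr4 RD4_J y0 yt yJt H).
have H0 : forall x y z w, RD4 x y z w = 0 /\ Rr4 x y z w = 0.
  exact: (const_hol_sec_curv_flat g_linear g_sym g_pos JK g_J Rr4_addl
    Rr4_skew12 Rr4_skew34 Rr4_bianchi Rr4_lee RD4_Rr4 RD4_J y0 yt yJt c0 H).
split; apply: (ip_eq0_mx G_unit) => z w; have [] := H0 (e_ a) (e_ b) z w;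
  by rewrite /RD4 /Rr4 !along2_delta.
Qed.
End PointwiseMatrices.

(** * Complex multilinear extension *)

Section CoordinateSums.
Variables (R : comPzRingType) (m : nat).
Implicit Types (X Y : 'rV[R]_m) (F H : 'I_m -> R).

Definition contract X F : R := \sum_a X 0 a * F a.

Lemma eq_contract X F H : F =1 H -> contract X F = contract X H.
Proof. by move=> FH; apply: eq_bigr => a _; rewrite FH. Qed.

Lemma contract_linear k X Y F : contract (k *: X + Y) F = k * contract X F + contract Y F.
Proof.
rewrite /contract mulr_sumr -big_split; apply: eq_bigr => a _ /=.
by rewrite !mxE; ring.
Qed.

Lemma contract_linear_fun k X F H :
  contract X (fun a => k * F a + H a) = k * contract X F + contract X H.
Proof.
by rewrite /contract mulr_sumr -big_split; apply: eq_bigr => a _ /=; ring.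
Qed.

Lemma contractC X Y (F : 'I_m -> 'I_m -> R) :
  contract X (fun a => contract Y (F a)) = contract Y (fun b => contract X (F^~ b)).
Proof.
rewrite /contract; under eq_bigr do rewrite mulr_sumr.
rewrite exchange_big /=; apply: eq_bigr => b _.
by rewrite mulr_sumr; apply: eq_bigr => a _; ring.
Qed.

Lemma contract_scale_fun k X F : contract X (fun a => k * F a) = k * contract X F.
Proof. by rewrite /contract mulr_sumr; apply: eq_bigr => a _; ring. Qed.

End CoordinateSums.

Section FormsAsSums.
Variables (R : realFieldType) (m : nat).
Implicit Types (u v z w : 'rV[R]_m).

Lemma ip_contract (G A : 'M[R]_m) z w :
  ip G (z *m A) w = contract z (fun c => contract w (fun e => (A *m G) c e)).
Proof.
rewrite /ip -(mulmxA z) -mulmxA mxE; apply: eq_bigr => c _; congr (_ * _).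
by rewrite mxE; apply: eq_bigr => e _; rewrite [w^T _ _]mxE mulrC.
Qed.

Lemma ip_along (G : 'M[R]_m) F u z w :
  ip G (z *m along F u) w = contract u (fun a => ip G (z *m F a) w).
Proof.
rewrite /ip /along mulmx_sumr !mulmx_suml summxE; apply: eq_bigr => a _.
by rewrite -scalemxAr -!scalemxAl mxE.
Qed.

Lemma ip_along2 (G : 'M[R]_m) (F : 'I_m -> 'I_m -> 'M[R]_m) u v z w :
  ip G (z *m along2 F u v) w =
  contract u (fun a => contract v (fun b => contract z (fun c => contract w (fun e =>
    (F a b *m G) c e)))).
Proof.
rewrite /along2 ip_along; apply: eq_contract => a; rewrite ip_along.
by apply: eq_contract => b; exact: ip_contract.
Qed.
End FormsAsSums.

Section Complexification.
Variables (R : realType) (m : nat).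
Local Notation cplx := (map_mx (real_complex R)).
Implicit Types (u v : 'rV[R]_m).

Lemma contract_cplx u (F : 'I_m -> R) :
  contract (cplx u) (fun a => (F a)%:C%C) = (contract u F)%:C%C.
Proof.
by rewrite /contract rmorph_sum; apply: eq_bigr => a _; rewrite mxE rmorphM.
Qed.

(** u - i Ju, the general vector of type (1,0), where K is the matrix of J. *)
Definition type10_of (K : 'M[R]_m) u : 'rV[R[i]]_m :=
  - 'i%C *: cplx (u *m K) + cplx u.

Lemma conj_type10_of K u :
  map_mx Num.conj (type10_of K u) = 'i%C *: cplx (u *m K) + cplx u.
Proof.
have conj_real (x : R) : Num.conj x%:C%C = x%:C%C by exact: conjc_real.
have conj_i : Num.conj 'i%C = - 'i%C :> R[i] by congr Complex; rewrite oppr0.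
apply/rowP => j; rewrite !mxE rmorphD rmorphM rmorphN /= conj_i opprK.
by rewrite !conj_real.
Qed.

(** For a skew bilinear form b, b(u - i v, u + i v) = 2 i b(u, v). *)
Lemma contract_skew_conj (u v : 'rV[R]_m) (F : 'I_m -> 'I_m -> R[i]) :
  (forall a b, F b a = - F a b) ->
  contract (- 'i%C *: cplx v + cplx u)
    (fun a => contract ('i%C *: cplx v + cplx u) (F a)) =
  2 * 'i%C * contract (cplx u) (fun a => contract (cplx v) (F a)).
Proof.
move=> Fs.
have sk X Y : contract X (fun a => contract Y (F a)) = - contract Y (fun a => contract X (F a)).
  rewrite contractC /contract -sumrN; apply: eq_bigr => a _; rewrite -mulrN -sumrN.
  by congr (_ * _); apply: eq_bigr => b _; rewrite Fs mulrN.
have s0 X : contract X (fun a => contract X (F a)) = 0.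
  have := sk X X => /eqP; rewrite -addr_eq0 -mulr2n mulrn_eq0 /=.
  by move/eqP.
have E X : contract X (fun a => contract ('i%C *: cplx v + cplx u) (F a)) =
  'i%C * contract X (fun a => contract (cplx v) (F a)) + contract X (fun a => contract (cplx u) (F a)).
  by rewrite -contract_linear_fun; apply: eq_contract => a; rewrite contract_linear.
rewrite contract_linear !E !s0 (sk (cplx v)).
by move: (contract _ _) 'i%C => x i; ring.
Qed.

End Complexification.

(** The expansion of T(u - i u', v + i v') for the complex bilinear extension of
    a real form T: p = T(u', v'), q = T(u', v), r = T(u, v'), s = T(u, v);
    the conclusion is that its imaginary part vanishes. *)
Lemma complex_split_eq0 (R : rcfType) (p q r s : R) :
  - 'i%C * ('i%C * p%:C%C + q%:C%C) + ('i%C * r%:C%C + s%:C%C) = 0 :> R[i] ->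
  q = r.
Proof.
have -> : - 'i%C * ('i%C * p%:C%C + q%:C%C) + ('i%C * r%:C%C + s%:C%C) =
    (p + s)%:C%C + 'i%C * (r - q)%:C%C :> R[i].
  have := sqr_i R; rewrite rmorphD rmorphB /=.
  move: 'i%C p%:C%C q%:C%C r%:C%C s%:C%C => j p' q' r' s' jj.
  have -> : - j * (j * p' + q') + (j * r' + s') =
    - (j ^+ 2) * p' + s' + j * (r' - q') by ring.
  by rewrite jj opprK mul1r.
move=> E; have := complexE ((p + s) +i* (r - q))%C; rewrite /= E => -[_ /subr0_eq].
exact: esym.
Qed.

(** * Chart expressions *)

Section Charts.
Variables (R : realType) (n : nat) (M : complex_manifold R n).
Variables (g : hermitian_metric M) (i : atlas M).
Implicit Types D : connection M.
Local Notation e_ a := (delta_mx (0 : 'I_1) (a : 'I_(n + n)) : 'rV[R]_(n + n)).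
Local Notation K := (Jmx : 'M[R]_(n + n)).
Let U := cod i.
Let G := gmx g i.

Let U_open : open U. Proof. exact: cod_open. Qed.

Lemma Jmx_sqr : K *m K = - 1%:M.
Proof.
rewrite /Jmx mulmx_block !(mul0mx, mulmx0, mulmxN, mulNmx, mulmx1).
by rewrite !(addr0, add0r) (scalar_mx_block n n) opp_block_mx !oppr0.
Qed.

(** Matrix of the endomorphism z |-> D_a z of constant fields. *)
Definition conn_mx D (a : 'I_(n + n)) (y : 'rV[R]_(n + n)) : 'M[R]_(n + n) :=
  \matrix_b gam D i y a b.

Lemma row_conn_mx D a y b : row b (conn_mx D a y) = gam D i y a b.
Proof. exact: rowK. Qed.

Lemma metric_smooth : smooth_mx U G.
Proof. by move=> a b; apply: gmx_smooth. Qed.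

Lemma derivable_conn_mx D : derivable_conn U (conn_mx D).
Proof.
move=> x Ux a b; apply/derivable_mxP => c d.
have -> : (fun y => conn_mx D b y c d) = (fun y => gam D i y b c 0 d).
  by apply/funext => y; rewrite mxE.
by have [_ /(_ a)] := @gam_smooth _ _ _ D i b c d [::] x Ux.
Qed.

Lemma curvature_row D a b c x : U x ->
  curvature D i x a b c = row c (curv_mx (conn_mx D) a b x).
Proof.
move=> Ux.
have dE d f e : 'D_(e_ d) (conn_mx D f) x c e =
    partial d (fun y => gam D i y f c 0 e) x.
  have <- : (fun y => conn_mx D f y c e) = (fun y => gam D i y f c 0 e).
    by apply/funext => y; rewrite mxE.
  have /is_derive_mxP/(_ c e)[_ E] :=
    derivable_conn_is_derive d f (@derivable_conn_mx D) Ux.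
  exact: esym E.
have mE f d : row c (conn_mx D f x *m conn_mx D d x) =
    \sum_h gam D i x f c 0 h *: gam D i x d h.
  rewrite row_mul row_conn_mx mulmx_sum_row.
  by apply: eq_bigr => h _; rewrite row_conn_mx.
rewrite /curvature /curv_mx !rowD !rowN !mE sumrB addrA; congr (_ + _ - _).
by apply/rowP => e; rewrite !mxE !dE.
Qed.

Lemma metric_connection_deriv D : metric_connection g D -> forall y, U y ->
  forall a, 'D_(e_ a) G y = conn_mx D a y *m G y + G y *m (conn_mx D a y)^T.
Proof.
move=> gD y Uy a; have [dG _] := smooth_mx_is_derive a metric_smooth Uy.
rewrite derive_mx //; apply/matrixP => b c; rewrite mxE addmxE.
rewrite [LHS](gD i y Uy a b c) -!row_conn_mx -!row_mul; congr (_ + _).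
  by rewrite mxE.
have -> : G y *m (conn_mx D a y)^T = (conn_mx D a y *m G y)^T.
  by rewrite trmx_mul (gmx_sym g Uy).
by rewrite !mxE.
Qed.

Lemma complex_connection_comm D : complex_connection D -> forall y, U y ->
  forall a, conn_mx D a y *m K = K *m conn_mx D a y.
Proof.
move=> JD y Uy a; apply/row_matrixP => b.
rewrite !row_mul row_conn_mx -JD // mulmx_sum_row.
by apply: eq_bigr => c _; rewrite row_conn_mx [row b _ _ _]mxE.
Qed.

Lemma torsion_free_conn D :
  (forall x, U x -> forall a b, torsion D i x a b = 0) -> forall y, U y ->
  forall a b, row a (conn_mx D b y) = row b (conn_mx D a y).
Proof.
by move=> T0 y Uy a b; rewrite !row_conn_mx; apply/subr0_eq/T0.
Qed.

Lemma parallel_form_deriv D t : parallel_form D t -> forall y, U y ->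
  forall a, 'D_(e_ a) (fmx t i) y = conn_mx D a y *m fmx t i y.
Proof.
move=> Dt y Uy a.
have ts : smooth_mx U (fmx t i) by move=> b c; rewrite (ord1 c); apply: fmx_smooth.
have [dt _] := smooth_mx_is_derive a ts Uy.
rewrite derive_mx //; apply/matrixP => b c; rewrite (ord1 c) mxE.
by rewrite [LHS](Dt i y Uy a b) -row_conn_mx -row_mul mxE.
Qed.

Lemma lee_form_deriv t : lee_form g t -> forall y, U y -> forall a b c,
  (K *m 'D_(e_ a) G y) b c + (K *m 'D_(e_ b) G y) c a
  + (K *m 'D_(e_ c) G y) a b = wedge12 (fmx t i y) (K *m G y) a b c.
Proof.
move=> tL y Uy a b c; rewrite -[RHS](tL i y Uy); rewrite /ext_deriv2 /partial.
have h d e f : 'D_(e_ d) (fun z => (K *m G z) e f) y = (K *m 'D_(e_ d) G y) e f.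
  have hK : is_derive y (e_ d) (fun=> K) 0 by apply: is_derive_cst.
  have := is_derive_mulmx hK (smooth_mx_is_derive d metric_smooth Uy).
  by rewrite mul0mx add0r => /is_derive_mxP /(_ e f) [_].
by rewrite /fundamental_form !h.
Qed.

Local Notation cplx := (map_mx (real_complex R)).

Lemma type10_type10_of (u : 'rV[R]_(n + n)) : type10 (type10_of K u).
Proof.
rewrite /type10 /type10_of mulmxDl -scalemxAl -!map_mxM /= -mulmxA Jmx_sqr.
rewrite mulmxN mulmx1 map_mxN scalerDr scalerA mulrN -expr2 sqr_i opprK scale1r.
by rewrite scalerN scaleNr opprK addrC.
Qed.

(** Vanishing of the complex torsion on u - i Ju and v + i Jv, imaginary part. *)
Lemma chern_torsion D : chern_connection g D -> forall y, U y -> forall u v,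
  v *m along (conn_mx D ^~ y) (u *m K) - (u *m K) *m along (conn_mx D ^~ y) v =
  (v *m K) *m along (conn_mx D ^~ y) u - u *m along (conn_mx D ^~ y) (v *m K).
Proof.
move=> [_ _ T11] y Uy u v.
pose T (p q : 'rV[R]_(n + n)) :=
  q *m along (conn_mx D ^~ y) p - p *m along (conn_mx D ^~ y) q.
have along_gam p q d : (q *m along (conn_mx D ^~ y) p) 0 d =
    contract p (fun a => contract q (fun b => gam D i y a b 0 d)).
  rewrite /along mulmx_sumr summxE; apply: eq_bigr => a _.
  rewrite -scalemxAr mxE; congr (_ * _); rewrite mxE; apply: eq_bigr => b _.
  by rewrite [conn_mx _ _ _ _ _]mxE.
have TE p q d : T p q 0 d =
    contract p (fun a => contract q (fun b => torsion D i y a b 0 d)).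
  rewrite /T !entryE !along_gam (contractC q) /contract -sumrB; apply: eq_bigr => a _.
  rewrite -mulrBr -sumrB; congr (_ * _); apply: eq_bigr => b _.
  by rewrite -mulrBr /torsion !entryE.
have TCE (X Y : 'rV[R[i]]_(n + n)) d : torsionC D i y X Y 0 d =
    contract X (fun a => contract Y (fun b => (torsion D i y a b 0 d)%:C%C)).
  rewrite /torsionC summxE; apply: eq_bigr => a _.
  rewrite summxE mulr_sumr; apply: eq_bigr => b _.
  by rewrite !mxE mulrA.
have TC p q d : contract (cplx p) (fun a => contract (cplx q) (fun b =>
    (torsion D i y a b 0 d)%:C%C)) = (T p q 0 d)%:C%C.
  by rewrite TE -contract_cplx; apply: eq_contract => a; exact: contract_cplx.
rewrite -/(T u (v *m K)) -/(T (u *m K) v); apply/rowP => d.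
have := T11 i y Uy _ _ (type10_type10_of u) (type10_type10_of v).
rewrite conj_type10_of => /rowP /(_ d); rewrite TCE /type10_of contract_linear.
have lin2 X : contract X (fun a => contract ('i%C *: cplx (v *m K) + cplx v)
    (fun b => (torsion D i y a b 0 d)%:C%C)) =
    'i%C * contract X (fun a => contract (cplx (v *m K)) (fun b => (torsion D i y a b 0 d)%:C%C))
    + contract X (fun a => contract (cplx v) (fun b => (torsion D i y a b 0 d)%:C%C)).
  by rewrite -contract_linear_fun; apply: eq_contract => a; rewrite contract_linear.
rewrite !lin2 !TC zeromxE; exact: complex_split_eq0.
Qed.

Section AtPoint.
Variables (D : connection M) (x : 'rV[R]_(n + n)).
Hypotheses (Dg : metric_connection g D) (Ux : U x).

Let Rm4 u v z w : R :=
  ip (G x) (z *m along2 (fun a b => curv_mx (conn_mx D) a b x) u v) w.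

Lemma gC_type10_of u : let X := type10_of K u in
  gC g i x X (map_mx Num.conj X) = 2 * (ip (G x) u u)%:C%C.
Proof.
move=> X; have gC_contract (Y Z : 'rV[R[i]]_(n + n)) : gC g i x Y Z =
    contract Y (fun a => contract Z (fun b => (G x a b)%:C%C)).
  apply: eq_bigr => a _; rewrite mulr_sumr; apply: eq_bigr => b _.
  by rewrite mulrA.
have gR p q : contract (cplx p) (fun a => contract (cplx q) (fun b => (G x a b)%:C%C)) =
    (ip (G x) p q)%:C%C.
  rewrite -[p in RHS]mulmx1 ip_contract -contract_cplx; apply: eq_contract => a.
  by rewrite contract_cplx mul1mx.
have g_lin2 Y p q : contract Y (fun a => contract ('i%C *: cplx p + cplx q)
    (fun b => (G x a b)%:C%C)) =
    'i%C * contract Y (fun a => contract (cplx p) (fun b => (G x a b)%:C%C))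
    + contract Y (fun a => contract (cplx q) (fun b => (G x a b)%:C%C)).
  by rewrite -contract_linear_fun; apply: eq_contract => a; rewrite contract_linear.
rewrite gC_contract conj_type10_of /X /type10_of contract_linear !g_lin2 !gR.
have -> : ip (G x) (u *m K) (u *m K) = ip (G x) u u.
  by rewrite /ip trmx_mul !mulmxA -(mulmxA u) -(mulmxA u) (gmx_hermitian g Ux).
rewrite (ip_sym (gmx_sym g Ux) (u *m K)).
have := sqr_i R; move: 'i%C (_%:C)%C (_%:C)%C => j q p jj.
by have -> : - j * (j * p + q) + (j * q + p) = - (j ^+ 2) * p + p; [ring | rewrite jj; ring].
Qed.

(** [contract_skew_conj] in the first and in the last pair of arguments gives
    (2 i)^2 R(u, Ju, u, Ju). *)
Lemma RmC_type10_of u : let X := type10_of K u in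
  RmC g D i x X (map_mx Num.conj X) X (map_mx Num.conj X) =
  4 * (Rm4 u (u *m K) (u *m K) u)%:C%C.
Proof.
move=> X; pose q a b c e : R := (curv_mx (conn_mx D) a b x *m G x) c e.
have q_skew12 a b c e : q b a c e = - q a b c e.
  by rewrite /q curv_mx_skew mulNmx oppmxE.
have q_skew34 a b c e : q a b e c = - q a b c e.
  have := curv_mx_metric U_open (@derivable_conn_mx D) metric_smooth
    (metric_connection_deriv Dg) a b Ux.
  move=> /matrixP /(_ c e); rewrite zeromxE addmxE.
  have -> : G x *m (curv_mx (conn_mx D) a b x)^T =
      (curv_mx (conn_mx D) a b x *m G x)^T by rewrite trmx_mul (gmx_sym g Ux).
  by rewrite [(_^T)%R _ _]mxE -/(q a b c e) -/(q a b e c); lra.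
have RmC_contract (Y Z V W : 'rV[R[i]]_(n + n)) : RmC g D i x Y Z V W =
    contract Y (fun a => contract Z (fun b => contract V (fun c => contract W (fun e =>
      (q a b c e)%:C%C)))).
  apply: eq_bigr => a _; rewrite mulr_sumr; apply: eq_bigr => b _.
  rewrite mulrA mulr_sumr; apply: eq_bigr => c _.
  rewrite mulrA mulr_sumr; apply: eq_bigr => e _.
  by rewrite mulrA curvature_row // -row_mul [row c _ _ _]mxE.
have RmE v w : Rm4 u v w u = contract u (fun a => contract v (fun b => contract w (fun c =>
  contract u (fun e => q a b c e)))) by exact: ip_along2.
rewrite RmC_contract conj_type10_of /X /type10_of contract_skew_conj; last first.
  move=> a b; rewrite -[RHS]mulN1r -contract_scale_fun; apply: eq_contract => c.
  rewrite -contract_scale_fun; apply: eq_contract => e.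
  by rewrite q_skew12 rmorphN mulN1r.
have inner a b : contract (- 'i%C *: cplx (u *m K) + cplx u)
    (fun c => contract ('i%C *: cplx (u *m K) + cplx u) (fun e => (q a b c e)%:C%C)) =
    2 * 'i%C * contract (cplx u) (fun c => contract (cplx (u *m K)) (fun e =>
      (q a b c e)%:C%C)).
  by apply: contract_skew_conj => c e; rewrite q_skew34 rmorphN.
have q_real : contract (cplx u) (fun a => contract (cplx (u *m K)) (fun b =>
    contract (cplx u) (fun c => contract (cplx (u *m K)) (fun e => (q a b c e)%:C%C)))) =
    (- Rm4 u (u *m K) (u *m K) u)%:C%C.
  rewrite RmE -mulN1r -contract_scale_fun -contract_cplx; apply: eq_contract => a.
  rewrite -contract_scale_fun -contract_cplx; apply: eq_contract => b.
  rewrite (contractC (u *m K)) -contract_scale_fun -contract_cplx; apply: eq_contract => c.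
  rewrite contract_cplx -contract_scale_fun; congr (_%:C%C); apply: eq_contract => e.
  by rewrite q_skew34 mulN1r.
have -> : contract (cplx u) (fun a => contract (cplx (u *m K)) (fun b =>
    contract (- 'i%C *: cplx (u *m K) + cplx u) (fun c =>
      contract ('i%C *: cplx (u *m K) + cplx u) (fun e => (q a b c e)%:C%C)))) =
    2 * 'i%C * (- Rm4 u (u *m K) (u *m K) u)%:C%C.
  rewrite -q_real -contract_scale_fun; apply: eq_contract => a.
  by rewrite -contract_scale_fun; apply: eq_contract => b; exact: inner.
have two_i_sqr (j p : R[i]) : j ^+ 2 = -1 -> 2 * j * (2 * j * - p) = 4 * p.
  move=> jj; have -> : 2 * j * (2 * j * - p) = - 4 * j ^+ 2 * p by ring.
  by rewrite jj; ring.
by rewrite rmorphN; apply: two_i_sqr; exact: sqr_i.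
Qed.

Lemma hol_sec_curv_real c : hol_sec_curv_const g D c ->
  forall u, Rm4 u (u *m K) (u *m K) u = c * ip (G x) u u ^+ 2.
Proof.
move=> Hc u; have [->|u0] := eqVneq u 0.
  by rewrite /Rm4 /ip !mul0mx mxE expr0n mulr0.
have gu : 0 < ip (G x) u u := gmx_pos g Ux u0.
have gC0 := gC_type10_of u; have RmC0 := RmC_type10_of u.
have X0 : type10_of K u != 0.
  apply/eqP => X0; move: gC0; rewrite /= X0 /gC big1 => [|a _].
    move/esym/eqP; rewrite mulf_eq0 pnatr_eq0 /= fmorph_eq0 => /eqP E.
    by rewrite E ltxx in gu.
  by apply: big1 => b _; rewrite mxE !mul0r.
have := Hc i x Ux _ (type10_type10_of u) X0.
rewrite /hol_sec_curv RmC0 gC0 => E; apply: (@complexI R).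
have p0 : (ip (G x) u u)%:C%C != 0 by rewrite fmorph_eq0 gt_eqF.
by rewrite rmorphM rmorphXn /= -E; field.
Qed.
End AtPoint.
End Charts.

(** * Constant holomorphic sectional curvature *)

Section ConstantHolomorphicSectionalCurvature.
Variables (R : realType) (n : nat) (M : complex_manifold R n).
Variables (g : hermitian_metric M) (D Dr : connection M) (t : one_form M).
Hypothesis n_ge2 : (2 <= n)%N.
Hypothesis chernD : chern_connection g D.
Hypothesis lcDr : levi_civita g Dr.
Hypothesis leet : lee_form g t.
Hypothesis parallelt : parallel_form Dr t.
Variable c : R.
Hypothesis H : hol_sec_curv_const g D c \/ hol_sec_curv_const g Dr c.

(** [weyl_shift_low] holds at every point of the chart, so it can be differentiated;
    this turns it into the relation between the two curvatures that
    [pointwise_const_hol_sec_curv] takes as a hypothesis. *)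
Lemma const_hol_sec_curv_chart i x : cod i x ->
  fmx t i x = 0 /\ (c = 0 -> forall a b,
    curv_mx (conn_mx i D) a b x = 0 /\ curv_mx (conn_mx i Dr) a b x = 0).
Proof.
move=> Ux; have [gD JD T11] := chernD; have [metricDr T0] := lcDr.
pose K : 'M[R]_(n + n) := Jmx; pose G := gmx g i; pose th := fmx t i.
pose CD := conn_mx i D; pose Cr := conn_mx i Dr.
have U_open : open (cod i) by exact: cod_open.
have th_smooth : smooth_mx (cod i) th.
  by move=> a b; rewrite (ord1 b); apply: fmx_smooth.
have DG := metric_connection_deriv gD; have DGr := metric_connection_deriv metricDr.
have Dth := parallel_form_deriv parallelt.
have CD_K := complex_connection_comm JD.
have Cr_sym := torsion_free_conn (T0 i).
have low y : cod i y -> forall a,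
    (CD a y + weyl_shift K a (th y) - Cr a y) *m G y = weyl_low (th y) (G y) a.
  move=> Uy a.
  apply: (weyl_shift_low (dG := fun a => 'D_(delta_mx 0 a) G y) (Ar := Cr ^~ y)
    (AD := CD ^~ y) (gmx_sym g Uy) (gmx_pos g Uy) (Jmx_sqr R n)
    (gmx_hermitian g Uy) (Cr_sym y Uy) (DGr i y Uy) (DG i y Uy) (CD_K i y Uy)).
  - exact: chern_torsion chernD _ Uy.
  - exact: lee_form_deriv leet _ Uy.
have dCr : derivable_conn (cod i) Cr by exact: derivable_conn_mx.
have dCD : derivable_conn (cod i) CD by exact: derivable_conn_mx.
have G_deriv y : cod i y -> forall a,
    is_derive y (delta_mx 0 a) G (Cr a y *m G y + G y *m (Cr a y)^T).
  by move=> Uy a; exact: (is_derive_metric (@metric_smooth _ _ _ g i) (DGr i) a Uy).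
have th_deriv y : cod i y -> forall a,
    is_derive y (delta_mx 0 a) th (Cr a y *m th y).
  by move=> Uy a; exact: (is_derive_parallel th_smooth (Dth i) a Uy).
have RD_Rr a b : curv_mx CD a b x *m G x = curv_mx Cr a b x *m G x
    + ((CD b x + weyl_shift K b (th x) - Cr b x)
         *m (CD a x + weyl_shift K a (th x) - Cr a x)
       - (CD a x + weyl_shift K a (th x) - Cr a x)
         *m (CD b x + weyl_shift K b (th x) - Cr b x)) *m G x
    - (1 / 2) *: (((K *m (Cr a x *m th x)) b 0 - (K *m (Cr b x *m th x)) a 0)
        *: (K *m G x)).
  have dW : derivable_conn (cod i) (fun a y => CD a y + weyl_shift K a (th y)).
    move=> y Uy d e; apply: derivableD; first exact: dCD.
    by have [] := is_derive_weyl_shift th_deriv K d e Uy.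
  have := curv_mx_conformal U_open dCr Cr_sym G_deriv th_deriv a b dW low Ux.
  rewrite (curv_mx_shift Cr_sym th_deriv a b dCD (CD_K i) Ux) /=.
  exact: unshift_curvature_identity.
have m_gt2 : (2 < n + n)%N by apply: leq_trans (leq_add n_ge2 n_ge2).
apply: (pointwise_const_hol_sec_curv (dG := fun a => 'D_(delta_mx 0 a) G x)
  (Ar := Cr ^~ x) (AD := CD ^~ x) (gmx_sym g Ux) (gmx_pos g Ux) (Jmx_sqr R n)
  (gmx_hermitian g Ux) (Cr_sym x Ux) (DGr i x Ux) (DG i x Ux) (CD_K i x Ux)
  (chern_torsion chernD Ux) (lee_form_deriv leet Ux)
  (Rr := fun a b => curv_mx Cr a b x) (RD := fun a b => curv_mx CD a b x)
  _ _ _ _ _ RD_Rr m_gt2).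
- by move=> a b; exact: curv_mx_skew.
- move=> a b.
  exact: (curv_mx_metric U_open dCr (@metric_smooth _ _ _ g i) (DGr i) a b Ux).
- by move=> a b d; exact: (curv_mx_bianchi U_open a b d dCr Cr_sym Ux).
- by move=> a b; exact: (curv_mx_parallel U_open dCr th_smooth (Dth i) a b Ux).
- by move=> a b; exact: (curv_mx_comm U_open a b dCD (CD_K i) Ux).
case: H => Hc; [left|right] => u.
  exact: (hol_sec_curv_real gD Ux Hc u).
exact: (hol_sec_curv_real metricDr Ux Hc u).
Qed.

Lemma const_hol_sec_curv_kahler : kahler g.
Proof.
move=> i x Ux a b d; rewrite (leet Ux).
by have [-> _] := const_hol_sec_curv_chart Ux; rewrite /wedge12 !mxE !mul0r !addr0.
Qed.

Lemma const_hol_sec_curv_zero_flat : c = 0 -> flat D /\ flat Dr.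
Proof.
move=> c0; split=> i x Ux a b d; rewrite curvature_row //;
  have [_ /(_ c0 a b) [E1 E2]] := const_hol_sec_curv_chart Ux;
  by rewrite (E1, E2) row0.
Qed.
End ConstantHolomorphicSectionalCurvature.

Theorem corollary2 (R : realType) (n : nat) (hn : (2 <= n)%N)
  (M : complex_manifold R n) (hM : compact [set: M])
  (g : hermitian_metric M)
  (D : connection M) (hD : chern_connection g D)
  (Dr : connection M) (hDr : levi_civita g Dr)
  (hV : vaisman g Dr) (c : R) :
  (hol_sec_curv_const g D c ->
     (c <> 0 -> kahler g) /\ (c = 0 -> flat D)) /\
  (hol_sec_curv_const g Dr c ->
     (c <> 0 -> kahler g) /\ (c = 0 -> flat Dr)).
Proof.
have [_ [t [leet parallelt]]] := hV.
have K := const_hol_sec_curv_kahler hn hD hDr leet parallelt.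
have F := const_hol_sec_curv_zero_flat hn hD hDr leet parallelt.
split=> H; (split=> [_|c0]; first by apply: (K c); [left + right]).
  by have [] := F c (or_introl H) c0.
by have [] := F c (or_intror H) c0.
Qed.
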